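(* Let $T=T_s$ be a tent map with slope $s\in(\sqrt2,2)$ and critical point $c=\tfrac12$. Let $\mathcal F$ and $\mathcal E$ denote the set of folding points and the set of endpoints of the core inverse limit space $\varprojlim\{[c_2,c_1],T|_{[c_2,c_1]}\}$. Then $\mathcal F=\mathcal E$ if and only if $c$ is persistently recurrent.
   Context: $T_s(x)=\min\{sx,s(1-x)\}$ on $[0,1]$; $c_k=T^k(c)$; the core $[c_2,c_1]$ is $T$-invariant. The core inverse limit space is $\{(\dots,x_{-2},x_{-1},x_0): x_{-i}\in[c_2,c_1],\ T(x_{-i})=x_{-(i-1)},\ i\in\mathbb N\}$ with the product metric $d(x,y)=\sum_{i\le0}2^{i}|x_i-y_i|$. A point $x$ of it is a folding point if it has no neighbourhood homeomorphic to the product of a Cantor set and an open interval; equivalently $x_{-m}\in\omega(c)$ for all $m\ge0$. A point $x$ is an endpoint if for any two subcontinua $A,B$ containing $x$, either $A\subset B$ or $B\subset A$. Persistent recurrence. For a finite backward orbit $\overline x=(x_{-l},\dots,x_{-1},x_0=x)$ under $T$ and an interval $J\ni x$, the pull-back of $J$ along $\overline x$ is the sequence $J_0=J$, and $J_{k+1}\ni x_{-k-1}$ the largest interval with $T(J_{k+1})\subseteq J_k$; it is monotone if $c\notin J_k^\circ$ for all $1\le k\le l$. When $c$ is recurrent ($c\in\omega(c)$), it is called reluctantly recurrent if there is $\delta>0$ such that for every $l\in\mathbb N$ there is a backward orbit $(x_{-l},\dots,x_{-1},x)$ in $\omega(c)$ such that $B(x,\delta)$ has a monotone pull-back along it; a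 recurrent $c$ that is not reluctantly recurrent is persistently recurrent (so a persistently recurrent $c$ is in particular recurrent). *)

(* Defs.v *)
From HB Require Import structures.
From mathcomp Require Import all_boot all_order all_algebra.
From mathcomp Require Import all_classical all_reals all_analysis.

Set Implicit Arguments.
Unset Strict Implicit.
Unset Printing Implicit Defensive.

Import Order.TTheory GRing.Theory Num.Theory.
Import numFieldNormedType.Exports.

Local Open Scope classical_set_scope.
Local Open Scope ring_scope.

Definition tent (R : realType) (s x : R) : R :=
  Num.min (s * x) (s * (1 - x)).

Definition crit (R : realType) : R := 2^-1.

(* [crit_orbit s k] is c_k, with c_0 = c. *)
Definition crit_orbit (R : realType) (s : R) (k : nat) : R :=
  iter k (tent s) (crit R).

Definition core (R : realType) (s : R) : set R :=
  `[crit_orbit s 2, crit_orbit s 1]%classic.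

Definition omega_limit (R : realType) (s : R) : set R :=
  cluster (crit_orbit s @ \oo).

(* A left-infinite sequence (..., x_{-2}, x_{-1}, x_0) is encoded as
   [x : nat -> R] with [x i] standing for x_{-i}. *)
Definition core_inverse_limit_set (R : realType) (s : R) : set (nat -> R) :=
  [set x | (forall i, core s (x i)) /\ (forall i, tent s (x i.+1) = x i)].

Definition core_inverse_limit (R : realType) (s : R) : Type :=
  set_type (core_inverse_limit_set s).

HB.instance Definition _ (R : realType) (s : R) :=
  Choice.on (core_inverse_limit s).

Section product_metric.
Context {R : realType} {s : R}.
Implicit Types x y z : core_inverse_limit s.

Definition il_coord x (i : nat) : R := \val x i.

Definition il_dist x y : R :=
  limn (series (fun i => 2^-1 ^+ i * `|il_coord x i - il_coord y i|)).

Lemma il_coord_core x i : core s (il_coord x i).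
Proof. by have /set_mem[+ _] := valP x; exact. Qed.

Lemma il_dist_is_cvg x y :
  cvgn (series (fun i => 2^-1 ^+ i * `|il_coord x i - il_coord y i|)).
Proof.
pose M : R := crit_orbit s 1 - crit_orbit s 2.
apply: (@series_le_cvg _ _ (geometric M 2^-1)) => [n|n|n|].
- by rewrite mulr_ge0// exprn_ge0// invr_ge0.
- rewrite /geometric /= mulr_ge0 ?exprn_ge0 ?invr_ge0// subr_ge0.
  have := il_coord_core x n; rewrite /core /= in_itv /= => /andP[h1 h2].
  exact: le_trans h1 h2.
- rewrite /geometric /= mulrC ler_wpM2r ?exprn_ge0 ?invr_ge0//.
  have := il_coord_core x n; rewrite /core /= in_itv /= => /andP[x1 x2].
  have := il_coord_core y n; rewrite /core /= in_itv /= => /andP[y1 y2].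
  rewrite ler_norml opprB; apply/andP; split; exact: lerB.
- apply: is_cvg_geometric_series.
  by rewrite ger0_norm ?invr_ge0// invf_lt1// ltr1n.
Qed.

Lemma il_distxx x : il_dist x x = 0.
Proof.
rewrite /il_dist [X in series X](_ : _ = (fun=> 0)).
  rewrite [series _](_ : _ = (fun=> 0)); first exact: lim_cst.
  by apply/funext => n; rewrite /series /= big1.
by apply/funext => n; rewrite subrr normr0 mulr0.
Qed.

Lemma il_dist_positivity x y : il_dist x y = 0 -> x = y.
Proof.
move=> d0; apply: val_inj; apply/funext => i; apply/eqP.
rewrite -subr_eq0 -normr_le0.
have p0 : 0 < 2^-1 ^+ i :> R by rewrite exprn_gt0// invr_gt0.
rewrite -(pmulr_rle0 _ p0) -d0.
have t0 : forall j, 0 <= 2^-1 ^+ j * `|il_coord x j - il_coord y j|.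
  by move=> j; rewrite mulr_ge0// exprn_ge0// invr_ge0.
have nd : nondecreasing_seq
    (series (fun j => 2^-1 ^+ j * `|il_coord x j - il_coord y j|)).
  by apply/nondecreasing_seqP => n; rewrite /series /= big_nat_recr//= lerDl.
have := nondecreasing_cvgn_le nd (@il_dist_is_cvg x y) i.+1.
rewrite -/(il_coord x i) -/(il_coord y i); apply: le_trans.
by rewrite /series /= big_nat_recr//= lerDr sumr_ge0.
Qed.

Lemma il_dist_sym x y : il_dist x y = il_dist y x.
Proof.
by rewrite /il_dist; congr (limn (series _)); apply/funext => n; rewrite distrC.
Qed.

Lemma il_dist_triangle y x z : il_dist x z <= il_dist x y + il_dist y z.
Proof.
have cxy := @il_dist_is_cvg x y; have cyz := @il_dist_is_cvg y z.
rewrite /il_dist -lim_seriesD//; apply: lim_series_le.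
- exact: il_dist_is_cvg.
- exact: is_cvg_seriesD.
move=> n; rewrite /= -mulrDr ler_wpM2l ?exprn_ge0 ?invr_ge0//.
exact: ler_distD.
Qed.

End product_metric.

HB.instance Definition _ (R : realType) (s : R) :=
  isMetric.Build R (core_inverse_limit s)
    (@il_distxx R s) (@il_dist_positivity R s) (@il_dist_sym R s)
    (@il_dist_triangle R s).

(* Homeomorphism between [A] and [B] with their subspace topologies; the
   values of [f] outside [A] and of [g] outside [B] are irrelevant. *)
Definition homeomorphic (S T : topologicalType) (A : set S) (B : set T) :=
  exists (f : S -> T) (g : T -> S),
    [/\ set_fun A B f, set_fun B A g,
        {within A, continuous f}, {within B, continuous g} &
        (forall a, A a -> g (f a) = a) /\ (forall b, B b -> f (g b) = b)].

Definition cantor_times_interval (R : realType) : set (cantor_space * R) :=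
  [set: cantor_space] `*` `]0, 1[%classic.

Definition folding_points (R : realType) (s : R) :
    set (core_inverse_limit s) :=
  [set x | ~ exists2 U, nbhs x U & homeomorphic U (@cantor_times_interval R)].

Arguments folding_points {R} s.

Definition subcontinuum (T : topologicalType) (A : set T) : Prop :=
  [/\ A !=set0, compact A & connected A].

Definition endpoints (R : realType) (s : R) : set (core_inverse_limit s) :=
  [set x | forall A B : set (core_inverse_limit s),
    subcontinuum A -> subcontinuum B -> A x -> B x ->
    A `<=` B \/ B `<=` A].

Arguments endpoints {R} s.

(* [x i] stands for x_{-i}; only the entries with [i <= l] matter. *)
Definition omega_backward_orbit (R : realType) (s : R) (l : nat)
    (x : nat -> R) : Prop :=
  (forall i, (i <= l)%N -> omega_limit s (x i)) /\
  (forall i, (i < l)%N -> tent s (x i.+1) = x i).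

Definition is_unit_subinterval (R : realType) (I : set R) : Prop :=
  is_interval I /\ I `<=` `[0, 1]%classic.

(* The tent map is a self-map of [0, 1], so pull-backs are taken there. *)
Definition is_pullback (R : realType) (s : R) (l : nat) (x : nat -> R)
    (J0 : set R) (J : nat -> set R) : Prop :=
  J 0%N = J0 /\
  forall k, (k < l)%N ->
    [/\ is_unit_subinterval (J k.+1), J k.+1 (x k.+1),
        tent s @` J k.+1 `<=` J k &
        forall I, is_unit_subinterval I -> I (x k.+1) ->
          tent s @` I `<=` J k -> I `<=` J k.+1].

Definition is_monotone_pullback (R : realType) (s : R) (l : nat)
    (x : nat -> R) (J0 : set R) (J : nat -> set R) : Prop :=
  is_pullback s l x J0 J /\
  forall k, (1 <= k <= l)%N -> ~ (J k)° (crit R).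

Definition recurrent (R : realType) (s : R) : Prop :=
  omega_limit s (crit R).

Definition reluctantly_recurrent (R : realType) (s : R) : Prop :=
  recurrent s /\
  exists2 delta : R, 0 < delta &
    forall l : nat, exists2 x : nat -> R, omega_backward_orbit s l x &
      exists J : nat -> set R,
        is_monotone_pullback s l x (ball (x 0%N) delta `&` `[0, 1]%classic) J.

Definition persistently_recurrent (R : realType) (s : R) : Prop :=
  recurrent s /\ ~ reluctantly_recurrent s.

(* Main.v *)
Require Import Defs.
From HB Require Import structures.
From mathcomp Require Import all_boot all_order all_algebra.
From mathcomp Require Import all_classical all_reals all_analysis.
From mathcomp Require Import ring lra.

(* A point [x] of the inverse limit [X] is determined by a coordinate [x_n] and the
   itinerary of [x_(n+1), x_(n+2), ...] with respect to [c], and moving [x_n] by [t] moves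
   [x_(n+k)] by [t / s^k] as long as [c] is not crossed. So everything is governed
   by the quantities [s^k |x_(n+k) - c|].

   - [x] is not an endpoint iff for some [n] and [d > 0] all [s^k |x_(n+k) - c|]
     are at least [d]. If so, sliding [x_n] over [x_n - d, x_n + d] is an arc
     through [x]. Conversely, for incomparable subcontinua [A], [B] at [x] there
     are [y] in [A] and [z] in [B] such that [x_m] separates [y_m] from [z_m] for
     all [m >= n]; were [x_(m+1)] too close to [c], then [x_m] would be too close
     to [c_1 = max T] to leave room for both.
   - [c] is reluctantly recurrent iff it is recurrent and some [x] of this kind has
     all coordinates in [omega(c)] (compactness of [X]); if [c] is not recurrent,
     every [x] with coordinates in [omega(c)] is of this kind.
   - If [x_i] is not in [omega(c)], some [x_m] has a neighbourhood free of the
     orbit of [c]; its preimage in [X] is the product of an interval with the fibre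
     over [x_m], a Cantor set.
   - If all [x_i] are in [omega(c)], then arbitrarily close to [x] there are arcs
     that fold: the points over [c + t] and [c - t] at level [M] agree in all
     coordinates below [M]. In a product neighbourhood of [x] such an arc is
     monotone, so folding forces it to stay in a small set, while
     [T^M [c, c + eta]] is the whole core for [M] large. *)

Set Implicit Arguments.
Unset Strict Implicit.
Unset Printing Implicit Defensive.

Import Order.TTheory GRing.Theory Num.Theory.
Import numFieldNormedType.Exports.

Local Open Scope classical_set_scope.
Local Open Scope ring_scope.

(** * The tent map *)

(** Bernoulli's inequality [k (q - 1) < q ^+ k] reduces this to the Archimedean property. *)
Lemma pow_unbounded (R : realType) (q a : R) : 1 < q -> exists k, a < q ^+ k.
Proof.
move=> q1; have q10 : 0 < q - 1 by rewrite subr_gt0.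
have [k ak] : exists k : nat, a / (q - 1) < k%:R.
  by exists (Num.truncn (a / (q - 1))).+1; exact: Num.Theory.truncnS_gt.
exists k; apply: (@lt_trans _ _ (k%:R * (q - 1))); first by rewrite -ltr_pdivrMr.
elim: k {ak} => [|k IH]; first by rewrite mul0r.
have k0 : (0 <= k%:R :> R) by [].
rewrite exprS -natr1; have := exprn_ege1 k (ltW q1); move: IH.
by move: (q ^+ k) k%:R k0 => a' b b0 h1 h2; nra.
Qed.

Section tent_map.
Context (R : realType) (s : R).
Hypotheses (s_gt0 : 0 < s) (s_sq : 2 < s ^+ 2) (s_lt2 : s < 2).

Local Notation T := (tent s).
Local Notation c := (crit R).
Local Notation orb := (crit_orbit s).

Lemma slope_gt1 : 1 < s.
Proof. by move: s_gt0 s_sq; rewrite expr2 => ? ?; nra. Qed.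

Lemma tent_left (x : R) : x <= c -> T x = s * x.
Proof.
rewrite /crit => xc; apply/min_idPl; rewrite ler_pM2l//; lra.
Qed.

Lemma tent_right (x : R) : c <= x -> T x = s * (1 - x).
Proof.
rewrite /crit => xc; apply/min_idPr; rewrite ler_pM2l//; lra.
Qed.

Lemma orbS k : orb k.+1 = T (orb k).
Proof. by []. Qed.

Lemma orb1 : orb 1 = s / 2.
Proof. by rewrite /crit_orbit/= tent_left. Qed.

Lemma crit_lt_orb1 : c < orb 1.
Proof. by rewrite orb1 /crit; have ? := slope_gt1; lra. Qed.

Lemma orb2 : orb 2 = s * (1 - s / 2).
Proof.
by rewrite orbS orb1 tent_right// -orb1 ltW// crit_lt_orb1.
Qed.

Lemma orb2_gt0 : 0 < orb 2.
Proof. by rewrite orb2 mulr_gt0// subr_gt0; have ? := s_lt2; lra. Qed.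

Lemma orb2_lt_crit : orb 2 < c.
Proof. by rewrite orb2 /crit; have ? := slope_gt1; nra. Qed.

Lemma orb1_lt1 : orb 1 < 1.
Proof. by rewrite orb1; have ? := s_lt2; lra. Qed.


Lemma orbD j k : orb (j + k) = iter j T (orb k).
Proof. by rewrite /crit_orbit iterD. Qed.

Lemma coreP (x : R) : core s x <-> orb 2 <= x <= orb 1.
Proof. by rewrite /core /= in_itv. Qed.

Lemma core_ge0 (x : R) : core s x -> 0 < x.
Proof. by move=> /coreP/andP[+ _]; apply: lt_le_trans orb2_gt0. Qed.

Lemma core_lt1 (x : R) : core s x -> x < 1.
Proof. by move=> /coreP/andP[_ x1]; apply: le_lt_trans x1 orb1_lt1. Qed.

Lemma tent_le_orb1 (x : R) : T x <= orb 1.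
Proof.
rewrite orb1; have [xc|xc] := leP x c.
  by rewrite tent_left// ler_pM2l.
by rewrite (tent_right (ltW xc)) ler_pM2l//; rewrite /crit in xc; lra.
Qed.

Lemma tent_unit (x : R) : 0 <= x <= 1 -> 0 <= T x <= 1.
Proof.
move=> /andP[x0 x1]; rewrite (le_trans (tent_le_orb1 x) (ltW orb1_lt1)) andbT.
by rewrite /tent le_min !mulr_ge0 ?subr_ge0//; exact: ltW.
Qed.

Lemma core_tent (x : R) : core s x -> core s (T x).
Proof.
move=> cx; have x0 := core_ge0 cx; move: cx => /coreP/andP[x2 x1].
apply/coreP; rewrite tent_le_orb1 andbT; have [xc|xc] := leP x c.
  by rewrite tent_left//; have ? := slope_gt1; nra.
by rewrite (tent_right (ltW xc)) orb2 ler_pM2l//; rewrite orb1 in x1; lra.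
Qed.

Lemma core_tent_right (x : R) : c <= x <= orb 1 -> core s (T x).
Proof.
move=> /andP[xc x1]; apply/core_tent/coreP; rewrite x1 andbT.
exact: le_trans (ltW orb2_lt_crit) xc.
Qed.

Lemma core_crit : core s c.
Proof. by apply/coreP; rewrite !ltW ?orb2_lt_crit ?crit_lt_orb1. Qed.

Lemma core_orb k : core s (orb k).
Proof. by elim: k => [|k]; [exact: core_crit|exact: core_tent]. Qed.

Lemma core_iter k (x : R) : core s x -> core s (iter k T x).
Proof. by move=> cx; elim: k => //= k; exact: core_tent. Qed.

Lemma tent_lip (x y : R) : `|T x - T y| <= s * `|x - y|.
Proof.
wlog xy : x y / x <= y => [h|].
  have [|/ltW] := leP x y; first exact: h.
  by rewrite (distrC x) (distrC (T x)); exact: h.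
have s0 := s_gt0.
rewrite (ler0_norm (x := x - y)) ?subr_le0// ler_norml.
have [xc|xc] := leP x c; have [yc|yc] := leP y c.
- by rewrite !tent_left//; nra.
- by rewrite (tent_left xc) (tent_right (ltW yc)); rewrite /crit in xc yc; nra.
- by move: (lt_le_trans xc (le_trans xy yc)); rewrite ltxx.
- by rewrite (tent_right (ltW xc)) (tent_right (ltW yc)); nra.
Qed.

Lemma iter_tent_lip k (x y : R) :
  `|iter k T x - iter k T y| <= s ^+ k * `|x - y|.
Proof.
elim: k => [|k IH]; first by rewrite mul1r.
by rewrite !iterS exprS -mulrA (le_trans (tent_lip _ _))// ler_wpM2l// ltW.
Qed.

(** The hypothesis keeps [y] on the same side of [c] as [x], where the tent map is affine of slope
    [s] or [- s]. *)
Lemma tent_expand (x y : R) : `|y - x| <= `|x - c| -> `|T y - T x| = s * `|y - x|.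
Proof.
move=> yx; have [xc|xc] := leP x c.
  have yc : y <= c.
    by move: yx; rewrite ler_norml (ler0_norm (x := x - c)) ?subr_le0// => ?; lra.
  by rewrite !tent_left// -mulrBr normrM gtr0_norm.
have yc : c <= y.
  by move: yx; rewrite ler_norml (gtr0_norm (x := x - c)) ?subr_gt0// => ?; lra.
rewrite (tent_right (ltW xc)) (tent_right yc) -mulrBr normrM gtr0_norm//.
by congr (_ * _); rewrite -normrN; congr (`| _ |); ring.
Qed.

Lemma continuous_tent : continuous T.
Proof.
move=> x; apply/(@cvgrPdist_lt _ R^o) => e e0; near=> y.
rewrite (le_lt_trans (tent_lip _ _))// -ltr_pdivlMl//.
near: y; apply: (@nbhsx_ballx R R^o).
by rewrite mulr_gt0// invr_gt0.
Unshelve. all: by end_near. Qed.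

Lemma continuous_iter_tent k : continuous (iter k T).
Proof.
elim: k => [|k IH] x; first exact: cvg_id.
by apply: (@continuous_comp _ _ _ (iter k T) T); [exact: IH|exact: continuous_tent].
Qed.

(** The symmetry of the tent map about [c]: an arc through [c] at some level is folded at every
    lower index. *)
Lemma iter_tent_symm k (t : R) : iter k.+1 T (c + t) = iter k.+1 T (c - t).
Proof.
rewrite !iterSr; congr iter.
rewrite /tent /crit minC; congr Num.min; by field.
Qed.

Lemma slope_pow_gt0 k : 0 < s ^+ k.
Proof. by rewrite exprn_gt0. Qed.


Lemma slope_pow_small (a e : R) : 0 < e -> exists k, a / s ^+ k < e.
Proof.
move=> e0; have [k ak] := pow_unbounded (a / e) slope_gt1; exists k.
by rewrite ltr_pdivrMr ?slope_pow_gt0// mulrC -ltr_pdivrMr.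
Qed.

End tent_map.

(** * The topology of the inverse limit *)

Section il_topology.
Context (R : realType) (s : R).
Hypotheses (s_gt0 : 0 < s) (s_sq : 2 < s ^+ 2) (s_lt2 : s < 2).

Local Notation T := (tent s).
Local Notation X := (core_inverse_limit s).
Local Notation K := (core_inverse_limit_set s).

Lemma il_coord_set (x : X) : K (il_coord x).
Proof. exact: set_mem (valP x). Qed.

Lemma il_tent (x : X) i : T (il_coord x i.+1) = il_coord x i.
Proof. by have [_] := il_coord_set x; apply. Qed.

Lemma il_iter (x : X) k i : iter k T (il_coord x (i + k)) = il_coord x i.
Proof.
by elim: k => [|k IH]; rewrite ?addn0// iterSr addnS il_tent.
Qed.

Lemma il_iterE (x : X) n i : (i <= n)%N ->
  il_coord x i = iter (n - i) T (il_coord x n).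
Proof. by move=> le_in; rewrite -{2}(subnKC le_in) il_iter. Qed.

Lemma il_ext (x y : X) : (forall i, il_coord x i = il_coord y i) -> x = y.
Proof. by move=> h; apply: val_inj; apply/funext. Qed.

Lemma il_coord_eq_le (x y : X) n i : (i <= n)%N ->
  il_coord x n = il_coord y n -> il_coord x i = il_coord y i.
Proof. by move=> le_in xy; rewrite !(il_iterE _ le_in) xy. Qed.

(** Points of the inverse limit are built from sequences by [insubd]; the default [x0] is returned
    only outside the inverse limit. *)
Lemma il_insubdE (x0 : X) (f : nat -> R) : K f ->
  il_coord (insubd x0 f) = f.
Proof. by move=> Kf; rewrite /il_coord insubdK//; exact: mem_set. Qed.

Lemma il_coord_dist1 (x y : X) i : `|il_coord x i - il_coord y i| <= 1.
Proof.
have cx := il_coord_core x i; have cy := il_coord_core y i.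
have [x0 x1] := (core_ge0 s_gt0 s_sq s_lt2 cx, core_lt1 s_gt0 s_lt2 cx).
have [y0 y1] := (core_ge0 s_gt0 s_sq s_lt2 cy, core_lt1 s_gt0 s_lt2 cy).
by rewrite ler_norml; apply/andP; split; lra.
Qed.

(** Lower coordinates are images of [x_n] under an iterate with Lipschitz constant at most [2 ^+ n],
    because [s < 2]. *)
Lemma il_coord_dist_le (x y : X) n i : (i <= n)%N ->
  `|il_coord x i - il_coord y i| <= 2 ^+ n * `|il_coord x n - il_coord y n|.
Proof.
move=> le_in; rewrite !(il_iterE _ le_in).
apply: le_trans (iter_tent_lip s_gt0 _ _ _) _.
rewrite ler_wpM2r// (@le_trans _ _ (2 ^+ (n - i)))//.
  by rewrite lerXn2r ?nnegrE ?ltW.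
by rewrite ler_weXn2l ?leq_subr// ler1n.
Qed.

Lemma il_coord_le_dist (x y : X) n :
  `|il_coord x n - il_coord y n| <= 2 ^+ n * il_dist x y.
Proof.
rewrite -ler_pdivrMl ?exprn_gt0// -exprVn.
set u := (fun j => 2^-1 ^+ j * `|il_coord x j - il_coord y j|).
have u0 j : 0 <= u j by rewrite mulr_ge0// exprn_ge0// invr_ge0.
have nd : nondecreasing_seq (series u).
  by apply/nondecreasing_seqP => m; rewrite /series /= big_nat_recr//= lerDl.
have := nondecreasing_cvgn_le nd (@il_dist_is_cvg _ _ x y) n.+1.
by apply: le_trans; rewrite /series /= big_nat_recr//= lerDr sumr_ge0.
Qed.

(** The indices up to [n] contribute at most [2 D], as each of these coordinate differences is at
    most [D]; the differences beyond are at most [1], so the tail is at most [2^-1 ^+ n]. *)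
Lemma il_dist_le (x y : X) n : il_dist x y <=
  2 * (2 ^+ n * `|il_coord x n - il_coord y n|) + 2^-1 ^+ n.
Proof.
set D := 2 ^+ n * _; have D0 : 0 <= D by rewrite mulr_ge0// exprn_ge0.
apply: limr_le; first exact: il_dist_is_cvg.
set u := (fun j => 2^-1 ^+ j * `|il_coord x j - il_coord y j|).
have hp j : (0 : R) < 2^-1 ^+ j by rewrite exprn_gt0// invr_gt0.
have head m : (m <= n.+1)%N -> series u m <= 2 * (1 - 2^-1 ^+ m) * D.
  elim: m => [|m IH] mn; first by rewrite /series/= big_geq// expr0 subrr mulr0 mul0r.
  have um : u m <= 2^-1 ^+ m * D.
    by rewrite /u ler_wpM2l ?(ltW (hp m))// il_coord_dist_le.
  rewrite /series/= big_nat_recr//= (le_trans (lerD (IH (ltnW mn)) um))//.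
  rewrite exprS le_eqVlt; apply/orP; left; apply/eqP.
  by field.
have tail m : series u (n.+1 + m)%N <= 2 * D + 2^-1 ^+ n * (1 - 2^-1 ^+ m).
  elim: m => [|m IH].
    rewrite addn0 expr0 subrr mulr0 addr0 (le_trans (head _ _))//.
    by rewrite mulrAC ler_piMr ?mulr_ge0// gerBl ltW.
  rewrite addnS /series/= big_nat_recr//= (le_trans (lerD IH (_ : _ <= 2^-1 ^+ (n.+1 + m))))//.
    by rewrite /u ler_piMr ?il_coord_dist1// ltW.
  rewrite exprD !exprS le_eqVlt; apply/orP; left; apply/eqP.
  by field.
have nd : nondecreasing_seq (series u).
  by apply/nondecreasing_seqP => m; rewrite /series /= big_nat_recr//= lerDl mulr_ge0// ltW.
apply: nearW => m.
rewrite (le_trans (nd _ _ (leq_addl n.+1 m)))// (le_trans (tail m))// lerD2l.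
by rewrite ler_piMr ?(ltW (hp _))// gerBl ltW.
Qed.

(** One coordinate suffices for a neighbourhood basis: it controls all lower indices, and the higher
    ones carry little weight in the metric. *)
Lemma nbhs_ilP (x : X) (A : set X) : nbhs x A <->
  exists n, exists2 d : R, 0 < d &
    forall y : X, `|il_coord x n - il_coord y n| < d -> A y.
Proof.
split.
  move/nbhs_ballP => [e /= e0 eA].
  have [n ne] : exists n : nat, 2^-1 ^+ n < e / 2.
    have two2 : 2 < 2 ^+ 2 :> R by rewrite -natrX ltr_nat.
    have e2 : 0 < e / 2 by rewrite divr_gt0.
    have [n ne] := slope_pow_small (ltr0n _ 2) two2 1 e2.
    by exists n; rewrite exprVn -div1r.
  exists n, (e / 4 / 2 ^+ n); first by rewrite !divr_gt0// exprn_gt0.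
  move=> y; rewrite ltr_pdivlMr ?exprn_gt0// mulrC => xy; apply: eA.
  rewrite ballEmdist/=; apply: le_lt_trans (il_dist_le x y n) _.
  by move: (2 ^+ n * _) (2^-1 ^+ n) xy ne => a b ? ?; lra.
move=> [n [d d0 dA]]; apply/nbhs_ballP; exists (d / 2 ^+ n) => /=.
  by rewrite divr_gt0// exprn_gt0.
move=> y; rewrite ballEmdist/= ltr_pdivlMr ?exprn_gt0// mulrC => xy.
exact: dA (le_lt_trans (il_coord_le_dist x y n) xy).
Qed.

Lemma continuous_il_coord n : continuous (fun x : X => il_coord x n).
Proof.
move=> x A /nbhs_ballP[e /= e0 eA].
by apply/nbhs_ilP; exists n, e => // y; exact: eA.
Qed.

Lemma cvg_il (S : Type) (F : set_system S) {FF : Filter F} (f : S -> X) (x : X) :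
  (forall n, (fun t => il_coord (f t) n) @ F --> il_coord x n) -> f @ F --> x.
Proof.
move=> h A /nbhs_ilP[n [d d0 dA]].
by move/(@cvgrPdist_lt _ R^o): (h n) => /(_ _ d0); apply: filterS => t; exact: dA.
Qed.

Lemma il_hausdorff : hausdorff_space X.
Proof. exact: metric_hausdorff. Qed.

Lemma closed_il_set : closed (K : set (prod_topology (fun _ : nat => R))).
Proof.
have -> : K = (\bigcap_i [set f | core s (f i)]) `&`
              (\bigcap_i [set f | T (f i.+1) - f i = 0]).
  rewrite eqEsubset; split => f [h1 h2]; split => i.
  - by move=> _; exact: h1.
  - by move=> _ /=; rewrite h2 subrr.
  - exact: h1.
  - by apply/subr0_eq; exact: h2.
have pc i : continuous (fun f : prod_topology (fun _ : nat => R) => f i).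
  exact: (@proj_continuous _ (fun _ => R)).
apply: closedI; apply: closed_bigI => i _.
  apply: (@closed_comp _ _ (fun f : prod_topology (fun _ : nat => R) => f i) (core s)).
    by move=> f _; exact: pc.
  exact: itv_closed.
apply: (@closed_comp _ _ (fun f : prod_topology (fun _ : nat => R) => T (f i.+1) - f i) [set 0]).
  move=> f _; apply: (@cvgB R R^o _ (nbhs f) _ (fun g => T (g i.+1)) (fun g => g i)); last exact: pc.
  apply: (@continuous_comp _ _ _ (fun f : prod_topology (fun _ : nat => R) => f i.+1) T).
    exact: pc.
  exact: continuous_tent.
exact: closed_eq.
Qed.

Lemma compact_il : compact [set: X].
Proof.
(* The map [insubd] needs a default point, so the empty space is set apart. Otherwise the space is a
   continuous image of a closed subset of a product of segments. *)
have [[x0 _]|noX] := pselect (nonempty [set: X]); last first.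
  rewrite (_ : [set: X] = set0); last by rewrite -subset0 => x _; apply: noX; exists x.
  exact: compact0.
have cK : compact (K : set (prod_topology (fun _ : nat => R))).
  apply: (@subclosed_compact (prod_topology (fun _ : nat => R)) _ [set f | forall i, core s (f i)]).
  - exact: closed_il_set.
  - by apply: (@tychonoff _ (fun _ : nat => R) (fun _ => core s)) => i; exact: segment_compact.
  - by move=> f [].
have -> : [set: X] = (fun f => insubd x0 f) @` K.
  rewrite eqEsubset; split => // x _; exists (il_coord x); first exact: il_coord_set.
  by apply: il_ext => i; rewrite il_insubdE//; exact: il_coord_set.
apply: continuous_compact cK; apply/subspace_continuousP => f Kf.
apply: cvg_il => n; rewrite il_insubdE//.
apply: (@cvg_trans _ ((fun g : prod_topology (fun _ : nat => R) => g n) @ within K (nbhs f))).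
  apply: near_eq_cvg; near=> g; rewrite il_insubdE//; near: g; exact: withinT.
apply: cvg_within_filter; exact: (@proj_continuous _ (fun _ => R)).
Unshelve. all: by end_near. Qed.

End il_topology.

(** * Inverse branches and itineraries *)

Section inverse_branches.
Context (R : realType) (s : R).

(** The two inverse branches of the tent map; [true] is the one to the right of [c]. *)
Definition branch (b : bool) (v : R) : R := if b then 1 - v / s else v / s.

Fixpoint branches (sg : nat -> bool) (k : nat) (v : R) : R :=
  if k is k'.+1 then branch (sg k') (branches sg k' v) else v.

(** The backward orbit through [v] at index [n]: lower indices are forced by iteration, higher ones
    are selected by [sg]. *)
Definition branch_point (n : nat) (sg : nat -> bool) (v : R) : nat -> R :=
  fun i => if (i <= n)%N then iter (n - i) (tent s) v else branches sg (i - n) v.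

(** Entry [k] tells which branch leads from index [n + k] to [n + k.+1]; the value [c] itself counts
    as right. *)
Definition itinerary (n : nat) (x : nat -> R) : nat -> bool :=
  fun k => crit R <= x (n + k.+1)%N.

Hypotheses (s_gt0 : 0 < s) (s_sq : 2 < s ^+ 2) (s_lt2 : s < 2).

Local Notation T := (tent s).
Local Notation c := (crit R).
Local Notation orb := (crit_orbit s).
Local Notation K := (core_inverse_limit_set s).

Lemma branch_side b (v : R) : v <= orb 1 ->
  if b then c <= branch b v else branch b v <= c.
Proof.
rewrite orb1// => v1; have vs : v / s <= 2^-1.
  by rewrite ler_pdivrMr// mulrC.
by case: b; rewrite /branch /crit; lra.
Qed.

Lemma tent_branch b (v : R) : v <= orb 1 -> T (branch b v) = v.
Proof.
have s0 : s != 0 by rewrite gt_eqF.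
move=> /(branch_side b); case: b => h; [rewrite tent_right//|rewrite tent_left//].
  by rewrite /branch; field.
by rewrite /branch; field.
Qed.

Lemma branch_tent (v : R) : branch (c <= v) (T v) = v.
Proof.
have s0 : s != 0 by rewrite gt_eqF.
have [h|/ltW h] := leP c v; [rewrite tent_right//|rewrite tent_left//].
  by rewrite /branch; field.
by rewrite /branch; field.
Qed.

Lemma core_branch_true (v : R) : core s v -> core s (branch true v).
Proof.
move=> /coreP/andP[v2 v1]; apply/coreP; apply/andP; split.
  exact: le_trans (ltW (orb2_lt_crit s_gt0 s_sq)) (branch_side true v1).
rewrite /branch orb1// lerBlDr -lerBlDl ler_pdivlMr//.
by move: v2; rewrite orb2// => v2; lra.
Qed.

(** As [orb 3 = s * orb 2], the left preimage [v / s] stays above [orb 2] exactly when [v] is at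
    least [orb 3]. *)
Lemma core_branch_false (v : R) : orb 3 <= v <= orb 1 -> core s (branch false v).
Proof.
move=> /andP[v3 v1]; apply/coreP; rewrite /branch.
apply/andP; split.
  rewrite ler_pdivlMr// mulrC; apply: le_trans v3.
  by rewrite (orbS _ 2) tent_left// (ltW (orb2_lt_crit _ _)).
apply: le_trans (ltW (crit_lt_orb1 s_gt0 s_sq)); exact: (branch_side false v1).
Qed.

Lemma branches_dist sg k (v w : R) :
  `|branches sg k v - branches sg k w| = `|v - w| / s ^+ k.
Proof.
elim: k => [|k IH] /=; first by rewrite divr1.
have -> : branch (sg k) (branches sg k v) - branch (sg k) (branches sg k w)
   = (if sg k then -1 else 1) * (branches sg k v - branches sg k w) / s.
  by case: (sg k); rewrite /branch; ring.
rewrite !normrM IH normfV (gtr0_norm s_gt0) exprS invfM -!mulrA (mulrC s^-1).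
by case: (sg k); rewrite ?normrN normr1 mul1r.
Qed.

Lemma branchesD sg j k (v : R) :
  branches sg (j + k) v = branches (fun i => sg (j + i)%N) k (branches sg j v).
Proof. by elim: k => [|k IH]; rewrite ?addn0// addnS /= IH. Qed.

Lemma eq_branches sg sg' k (v : R) : (forall i, (i < k)%N -> sg i = sg' i) ->
  branches sg k v = branches sg' k v.
Proof.
elim: k => //= k IH h; rewrite h// IH// => i ik; apply: h; exact: ltnW.
Qed.

Lemma continuous_branches sg k : continuous (branches sg k).
Proof.
move=> x; apply/(@cvgrPdist_lt _ R^o) => e e0; near=> y.
rewrite branches_dist ltr_pdivrMr ?slope_pow_gt0//.
near: y; apply: (@nbhsx_ballx R R^o).
by rewrite mulr_gt0// slope_pow_gt0.
Unshelve. all: by end_near. Qed.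

Lemma branch_point_le n sg (v : R) i : (i <= n)%N ->
  branch_point n sg v i = iter (n - i) T v.
Proof. by rewrite /branch_point => ->. Qed.

Lemma branch_pointD n sg (v : R) k : branch_point n sg v (n + k) = branches sg k v.
Proof.
rewrite /branch_point; case: k => [|k]; first by rewrite addn0 leqnn subnn.
by rewrite leqNgt addnS ltnS leq_addr/= -addnS addKn.
Qed.

Lemma branch_point_id n sg (v : R) : branch_point n sg v n = v.
Proof. by rewrite branch_point_le// subnn. Qed.

Lemma continuous_branch_point n sg i : continuous (fun v => branch_point n sg v i).
Proof.
rewrite /branch_point; have [_|_] := leqP i n; first exact: continuous_iter_tent.
exact: continuous_branches.
Qed.

Lemma branch_point_il n sg (v : R) : (forall k, core s (branches sg k v)) ->
  K (branch_point n sg v).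
Proof.
move=> h; have cv : core s v by exact: (h 0%N).
split=> i; rewrite /branch_point; first by case: ifP => _ //; exact: core_iter.
have [i_lt|i_ge] := ltnP i n.
  by rewrite (ltnW i_lt) -iterS subnSK.
rewrite subSn//= tent_branch; last by have /coreP/andP[] := h (i - n)%N.
case: ifP => // i_le; have -> : i = n by apply/eqP; rewrite eqn_leq i_le.
by rewrite subnn.
Qed.

Lemma branches_itinerary n (x : nat -> R) : K x ->
  forall k, branches (itinerary n x) k (x n) = x (n + k)%N.
Proof.
move=> [_ Tx]; elim=> [|k IH]; first by rewrite addn0.
by rewrite /= IH -(Tx (n + k)%N) -addnS branch_tent.
Qed.

Lemma branch_point_itinerary n (x : nat -> R) : K x ->
  branch_point n (itinerary n x) (x n) = x.
Proof.
move=> Kx; apply/funext => i; rewrite /branch_point.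
have [i_le|i_gt] := leqP i n; last by rewrite branches_itinerary// subnKC// ltnW.
case: Kx => _ Tx; rewrite -{2}(subnKC i_le).
by elim: (n - i)%N => [|k IH]; rewrite ?addn0// addnS iterSr Tx IH.
Qed.

(** At [c] the two branches meet and the itinerary always reads [true]; hence the condition
    [!= c]. *)
Lemma itinerary_branch_point n sg (v : R) :
  (forall k, core s (branches sg k v)) -> (forall k, branches sg k.+1 v != c) ->
  itinerary n (branch_point n sg v) = sg.
Proof.
move=> cv vc; apply/funext => k; rewrite /itinerary branch_pointD.
have := vc k; have /coreP/andP[_ v1] := cv k; have := branch_side (sg k) v1.
rewrite /=; case: (sg k) => // h1 h2.
by apply: negbTE; rewrite -ltNge lt_neqAle h2.
Qed.

(** No coordinate crosses [c] while [x n] is moved to [t], so the moved sequence [z] is still a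
    backward orbit. Being images, its entries are at most [c_1]; the lower bound comes from a later
    entry in [[c, c_1]], whose forward orbit stays in the core. *)
Lemma core_slide n (x : nat -> R) (t : R) : K x ->
  (forall k, `|t - x n| <= s ^+ k.+1 * `|x (n + k.+1)%N - c|) ->
  forall k, core s (branches (itinerary n x) k t).
Proof.
move=> Kx tx; set sg := itinerary n x; set z := branches sg ^~ t.
have side k : if sg k then c <= z k.+1 else z k.+1 <= c.
  have zx : `|z k.+1 - x (n + k.+1)%N| <= `|x (n + k.+1)%N - c|.
    rewrite -(branches_itinerary n Kx) branches_dist (branches_itinerary n Kx).
    by rewrite ler_pdivrMr ?slope_pow_gt0// mulrC.
  move: zx; rewrite /sg /itinerary; case: (leP c (x _)) => xc.
    by rewrite (ger0_norm (_ : 0 <= x _ - c)) ?subr_ge0// ler_norml => /andP[? ?]; lra.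
  by rewrite (ltr0_norm (_ : x _ - c < 0)) ?subr_lt0// ler_norml => /andP[? ?]; lra.
have Tz k : T (z k.+1) = z k.
  have s0 : s != 0 by rewrite gt_eqF.
  have := side k; rewrite /z /=; case: (sg k) => h; [rewrite tent_right//|rewrite tent_left//].
    by rewrite /branch; field.
  by rewrite /branch; field.
have z1 k : z k <= orb 1 by rewrite -Tz; exact: tent_le_orb1.
(* Were all coordinates beyond [n + k] to the left of [c], then [x (n + k) = s ^+ m * x (n + k + m)]
   would be at least [s ^+ m * orb 2], which exceeds [1] for large [m]. *)
move=> k; have [j sgj] : exists j, sg (k + j)%N.
  apply: contrapT => /forallNP nsg.
  have xk m : x (n + k)%N = s ^+ m * x (n + k + m)%N.
    elim: m => [|m ->]; first by rewrite addn0 mul1r.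
    rewrite exprSr -mulrA; congr (_ * _); case: (Kx) => _ <-.
    rewrite addnS tent_left// ltW// ltNge; apply/negP => h; apply: (nsg m).
    by rewrite /sg /itinerary addnS addnA.
  have [m] := pow_unbounded (1 / orb 2) (slope_gt1 s_gt0 s_sq).
  rewrite ltr_pdivrMr ?orb2_gt0// => big.
  have [cx _] := Kx; have := core_lt1 s_gt0 s_lt2 (cx (n + k)%N).
  rewrite (xk m) ltNge => /negP; apply; apply: le_trans (ltW big) _.
  by rewrite ler_wpM2l ?(ltW (slope_pow_gt0 s_gt0 m))//; have /coreP/andP[] := cx (n + k + m)%N.
have cz : core s (z (k + j)%N).
  rewrite -Tz; apply: core_tent_right => //; rewrite z1 andbT.
  by have := side (k + j)%N; rewrite sgj.
have -> : branches sg k t = iter j T (z (k + j)%N).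
  by elim: {sgj cz} j => [|j ->]; rewrite ?addn0// addnS iterSr Tz.
exact: core_iter.
Qed.

Lemma core_branches_true k (v : R) : core s v -> core s (branches (fun=> true) k v).
Proof. by move=> cv; elim: k => //= k; exact: core_branch_true. Qed.

(** The right branch contracts towards the fixed point [p = s / (1 + s)] of the tent map, and
    [s ^+ 2 > 2] places [p] strictly above [orb 3]. Thus every backward orbit of right branches
    reaches a point where the left branch is also available in the core. *)
Lemma branches_true_ge_orb3 (v : R) : exists k, orb 3 <= branches (fun=> true) k v.
Proof.
pose p := s / (1 + s); have s0 : s != 0 by rewrite gt_eqF.
have s1 : 1 + s != 0 by rewrite gt_eqF// addr_gt0.
have pk k : branches (fun=> true) k p = p.
  by elim: k => //= k ->; rewrite /p /branch; field; rewrite s0 s1.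
have p3 : 0 < p - orb 3.
  have -> : p - orb 3 = s * ((s - 1) * (s ^+ 2 - 2)) / (2 * (1 + s)).
    rewrite orbS tent_left ?ltW ?orb2_lt_crit// orb2// /p; field.
    by rewrite s1.
  have s_gt1 := slope_gt1 s_gt0 s_sq.
  by rewrite divr_gt0// mulr_gt0 ?addr_gt0// mulr_gt0// subr_gt0.
have [k] := slope_pow_small s_gt0 s_sq `|v - p| p3.
rewrite -(branches_dist (fun=> true)) pk => /ltW h; exists k.
by move: h; rewrite ler_norml => /andP[? ?]; lra.
Qed.

End inverse_branches.

(** * Endpoints *)

Section endpoint_characterization.
Context (R : realType) (s : R).
Hypotheses (s_gt0 : 0 < s) (s_sq : 2 < s ^+ 2) (s_lt2 : s < 2).

Local Notation c := (crit R).
Local Notation orb := (crit_orbit s).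
Local Notation X := (core_inverse_limit s).
Local Notation K := (core_inverse_limit_set s).

(** The number [d] is a distance by which [x n] can be slid in both directions without a higher
    coordinate crossing [c]. *)
Definition crit_repelled (n : nat) (d : R) (x : nat -> R) : Prop :=
  forall k, d <= s ^+ k.+1 * `|x (n + k.+1)%N - c|.

(** A neighbourhood of [y] disjoint from [B] is detected by a single coordinate [n], and agreement
    at an index above [n] forces agreement at [n]. *)
Lemma closed_coord_separated (B : set X) (y : X) : closed B -> ~ B y ->
  exists n, forall m, (n <= m)%N -> forall b, B b -> il_coord b m != il_coord y m.
Proof.
move=> clB nBy; have : nbhs y (~` B).
  by apply: open_nbhs_nbhs; split => //; exact: closed_openC.
move=> /(nbhs_ilP s_gt0 s_sq s_lt2)[n [d d0 dB]]; exists n => m nm b Bb.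
apply/eqP => bm; apply: (dB b) => //.
by rewrite (il_coord_eq_le nm bm) subrr normr0.
Qed.

Lemma connected_coord_interval (A : set X) m : connected A ->
  is_interval ((fun x => il_coord x m) @` A).
Proof.
move=> cA; apply/connected_intervalP; apply: connected_continuous_connected => //.
exact/continuous_subspaceT/continuous_il_coord.
Qed.

Lemma not_endpoint_repelled (x : X) : ~ endpoints s x ->
  exists n, exists2 d, 0 < d & crit_repelled n d (il_coord x).
Proof.
move=> /existsNP[A] /existsNP[B] /not_implyP[[_ kA cA]] /not_implyP[[_ kB cB]].
move=> /not_implyP[Ax] /not_implyP[Bx] /not_orP[AB BA].
have /existsNP[y /not_implyP[Ay nBy]] := AB.
have /existsNP[y' /not_implyP[By' nAy']] := BA.
have hd := @il_hausdorff R s.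
have [n1 By] := closed_coord_separated (compact_closed hd kB) nBy.
have [n2 Ay'] := closed_coord_separated (compact_closed hd kA) nAy'.
pose n := maxn n1 n2.
pose p m := il_coord y m; pose q m := il_coord y' m; pose z m := il_coord x m.
(* The projections of [A] and [B] to coordinate [m] are intervals through [z m]. The first contains
   [p m] but not [q m], the second [q m] but not [p m], so [p m] and [q m] lie on opposite sides of
   [z m]. *)
have sep m : (n <= m)%N -> (p m < z m < q m) \/ (q m < z m < p m).
  move=> nm; have iA := @connected_coord_interval A m cA.
  have iB := @connected_coord_interval B m cB.
  have := By m (leq_trans (leq_maxl _ _) nm).
  have := Ay' m (leq_trans (leq_maxr _ _) nm).
  rewrite -/(p m) -/(q m) => Aq Bp.
  have pB : ~ ((fun x => il_coord x m) @` B) (p m).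
    by move=> [b Bb bp]; move: (Bp b Bb); rewrite bp eqxx.
  have qA : ~ ((fun x => il_coord x m) @` A) (q m).
    by move=> [a Aa aq]; move: (Aq a Aa); rewrite aq eqxx.
  have Ap : ((fun x => il_coord x m) @` A) (p m) by exists y.
  have Az : ((fun x => il_coord x m) @` A) (z m) by exists x.
  have Bq : ((fun x => il_coord x m) @` B) (q m) by exists y'.
  have Bz : ((fun x => il_coord x m) @` B) (z m) by exists x.
  have [pz|zp] := leP (z m) (p m); have [qz|zq] := leP (z m) (q m).
  - exfalso; have [pq|/ltW qp] := leP (p m) (q m).
      by apply: pB; apply: (iB _ _ Bz Bq); rewrite pz.
    by apply: qA; apply: (iA _ _ Az Ap); rewrite qz.
  - right => /=; rewrite ?zq lt_neqAle pz andbT; apply/eqP => zpm.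
    by apply: pB; rewrite -zpm.
  - left => /=; rewrite ?zp lt_neqAle qz andbT; apply/eqP => zqm.
    by apply: qA; rewrite -zqm.
  - exfalso; have [pq|/ltW qp] := leP (p m) (q m).
      by apply: qA; apply: (iA _ _ Ap Az); rewrite pq ltW.
    by apply: pB; apply: (iB _ _ Bq Bz); rewrite qp ltW.
exists n; exists (Num.min `|p n - z n| `|q n - z n|).
  rewrite lt_min !normr_gt0 !subr_eq0.
  by have [/andP[h1 h2]|/andP[h1 h2]] := sep n (leqnn _);
    rewrite ?(lt_eqF h1) ?(gt_eqF h1) ?(lt_eqF h2) ?(gt_eqF h2).
move=> k; rewrite leNgt; apply/negP => small.
(* A point above [z (n + k)] is squeezed between it and [c_1 = T c], so its distance to [z (n + k)]
   is at most [s * |z (n + k.+1) - c|]. One of [y], [y'] is such a point. *)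
have key (r : X) : z (n + k)%N < il_coord r (n + k)%N ->
    `|il_coord r n - z n| <= s ^+ k.+1 * `|z (n + k.+1)%N - c|.
  move=> zr; rewrite -(il_iter r k n) /z -(il_iter x k n).
  apply: le_trans (iter_tent_lip s_gt0 _ _ _) _.
  rewrite exprSr -mulrA ler_wpM2l ?(ltW (slope_pow_gt0 s_gt0 k))//.
  apply: le_trans (tent_lip s_gt0 _ _); rewrite addnS il_tent -/(orb 1).
  rewrite distrC ltr0_norm ?subr_lt0// opprB.
  have /coreP/andP[_ r1] := il_coord_core r (n + k)%N.
  by rewrite distrC (le_trans _ (ler_norm _))// lerD2r.
move: small; rewrite lt_min => /andP[hp hq].
have [/andP[_ h]|/andP[_ h]] := sep (n + k)%N (leq_addr _ _).
  by have := key y' h; rewrite leNgt hq.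
by have := key y h; rewrite leNgt hp.
Qed.

(** The point [x] slid to have coordinate [t] at [n], with its itinerary kept; [x] also serves as
    the default when no such point exists. *)
Definition il_path (x : X) n (t : R) : X :=
  insubd x (branch_point s n (itinerary n (il_coord x)) t).

Lemma repelled_branch_point_il (x : X) n d (t : R) :
  crit_repelled n d (il_coord x) -> `|t - il_coord x n| <= d ->
  K (branch_point s n (itinerary n (il_coord x)) t).
Proof.
move=> xd td; apply: branch_point_il => //; apply: core_slide => //.
  exact: il_coord_set.
by move=> k; exact: le_trans td (xd k).
Qed.

Lemma continuous_il_path (x : X) n d (A : set R) :
  crit_repelled n d (il_coord x) ->
  (forall t, A t -> `|t - il_coord x n| <= d) ->
  {within A, continuous (il_path x n)}.
Proof.
move=> xd Ad; apply/subspace_continuousP => t At.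
apply: cvg_il => // i; rewrite /il_path il_insubdE; last first.
  by apply: repelled_branch_point_il xd _; exact: Ad.
apply: (@cvg_trans _ ((fun t => branch_point s n (itinerary n (il_coord x)) t i) @ within A (nbhs t))).
  apply: near_eq_cvg; near=> u; rewrite il_insubdE//.
  apply: repelled_branch_point_il xd _; apply: Ad.
  by near: u; exact: withinT.
by apply: cvg_within_filter; exact: continuous_branch_point.
Unshelve. all: by end_near. Qed.

(** Sliding [x_n] down and up by [d] gives two arcs at [x]; neither contains the far end of the
    other, as coordinate [n] shows. *)
Lemma repelled_not_endpoint (x : X) n d : 0 < d ->
  crit_repelled n d (il_coord x) -> ~ endpoints s x.
Proof.
move=> d0 xd; set xn := il_coord x n.
have Ad1 t : `[xn - d, xn]%classic t -> `|t - xn| <= d.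
  by rewrite /= in_itv/= ler_norml => /andP[? ?]; apply/andP; split; lra.
have Ad2 t : `[xn, xn + d]%classic t -> `|t - xn| <= d.
  by rewrite /= in_itv/= ler_norml => /andP[? ?]; apply/andP; split; lra.
have path_coord t : `|t - xn| <= d -> il_coord (il_path x n t) n = t.
  move=> td; rewrite il_insubdE ?branch_point_id//.
  exact: repelled_branch_point_il td.
have path_x : il_path x n xn = x.
  apply: val_inj; rewrite /il_path branch_point_itinerary//; last exact: il_coord_set.
  rewrite insubdK//; apply: mem_set; exact: il_coord_set.
have sub (a b : R) : a <= b -> (forall t, `[a, b]%classic t -> `|t - xn| <= d) ->
    subcontinuum (il_path x n @` `[a, b]%classic).
  move=> ab Ad; split.
  - by exists (il_path x n a), a => //=; rewrite in_itv/= lexx.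
  - apply: continuous_compact; last exact: segment_compact.
    exact: continuous_il_path xd Ad.
  - apply: connected_continuous_connected; last exact: continuous_il_path xd Ad.
    by apply/connected_intervalP; exact: interval_is_interval.
have dle : `|xn - d - xn| <= d by rewrite addrAC subrr add0r normrN gtr0_norm.
have dle' : `|xn + d - xn| <= d by rewrite addrAC subrr add0r gtr0_norm.
have sub1 := sub _ _ (_ : xn - d <= xn) Ad1.
have sub2 := sub _ _ (_ : xn <= xn + d) Ad2.
rewrite gerBl (ltW d0) in sub1; rewrite lerDl (ltW d0) in sub2.
move=> ex; have [||AB|BA] := ex _ _ (sub1 isT) (sub2 isT).
- by exists xn => //=; rewrite in_itv/= lexx gerBl ltW.
- by exists xn => //=; rewrite in_itv/= lexx lerDl ltW.
- have [|u /=] := AB (il_path x n (xn - d)).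
    by exists (xn - d) => //=; rewrite in_itv/= lexx gerBl ltW.
  move=> u_in /(congr1 (fun y => il_coord y n)).
  rewrite !path_coord//; last exact: Ad2.
  by move: u_in; rewrite in_itv/= => /andP[? ?] ?; lra.
- have [|u /=] := BA (il_path x n (xn + d)).
    by exists (xn + d) => //=; rewrite in_itv/= lexx lerDl ltW.
  move=> u_in /(congr1 (fun y => il_coord y n)).
  rewrite !path_coord//; last exact: Ad1.
  by move: u_in; rewrite in_itv/= => /andP[? ?] ?; lra.
Qed.

End endpoint_characterization.

(** * Recurrence *)

Section recurrence.
Context (R : realType) (s : R).
Hypotheses (s_gt0 : 0 < s) (s_sq : 2 < s ^+ 2) (s_lt2 : s < 2).

Local Notation T := (tent s).
Local Notation c := (crit R).
Local Notation orb := (crit_orbit s).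
Local Notation X := (core_inverse_limit s).
Local Notation K := (core_inverse_limit_set s).

Lemma omega_limitP (y : R) : omega_limit s y <->
  forall e, 0 < e -> forall N, exists2 j, (N <= j)%N & `|orb j - y| < e.
Proof.
split=> [oy e e0 N|h A B].
  have [] := oy [set orb j | j in [set j | (N <= j)%N]] (ball y e).
  - by exists N => // j /= Nj; exists j.
  - exact: nbhsx_ballx.
  move=> _ [[j /= Nj <-]] jy; exists j => //.
  by move: jy; rewrite -ball_normE/= distrC.
move=> [N _ NA] /nbhs_ballP[e /= e0 eB]; have [j Nj jy] := h e e0 N.
exists (orb j); split; first exact: NA.
by apply: eB; rewrite -ball_normE/= distrC.
Qed.

Lemma omega_core (y : R) : omega_limit s y -> core s y.
Proof.
move=> /omega_limitP oy; apply/coreP/andP; split; rewrite leNgt; apply/negP => h.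
  rewrite -subr_gt0 in h; have [j _] := oy _ h 0%N.
  have /coreP/andP[+ _] := core_orb s_gt0 s_sq s_lt2 j.
  by move=> hj; rewrite ltr_norml => /andP[_ ?]; lra.
rewrite -subr_gt0 in h; have [j _] := oy _ h 0%N.
have /coreP/andP[_ +] := core_orb s_gt0 s_sq s_lt2 j.
by move=> hj; rewrite ltr_norml => /andP[? _]; lra.
Qed.

Lemma omega_closure (y : R) :
  (forall e, 0 < e -> exists2 z, omega_limit s z & `|z - y| < e) -> omega_limit s y.
Proof.
move=> h; apply/omega_limitP => e e0 N.
have e2 : 0 < e / 2 by rewrite divr_gt0.
have [z /omega_limitP oz zy] := h _ e2; have [j Nj jz] := oz _ e2 N; exists j => //.
by rewrite (le_lt_trans (ler_distD z _ _))// [ltRHS]splitr ltrD.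
Qed.

Lemma il_inhabited : exists x : X, True.
Proof.
have Kx : K (branch_point s 0 (fun=> true) c).
  apply: branch_point_il => // k; apply: core_branches_true => //; exact: core_crit.
by exists (insubd (SigSub (mem_set Kx)) (branch_point s 0 (fun=> true) c)).
Qed.

Lemma il_cluster (u : nat -> X) : exists x : X, forall i e, 0 < e ->
  forall N, exists2 n, (N <= n)%N & `|il_coord x i - il_coord (u n) i| < e.
Proof.
have [x [_ ux]] := @compact_il R s s_gt0 s_sq s_lt2 (u @ \oo) _ filterT.
exists x => i e e0 N.
have [] := ux [set u n | n in [set n | (N <= n)%N]]
  [set y | `|il_coord x i - il_coord y i| < e].
- by exists N => // n /= Nn; exists n.
- by apply/nbhs_ilP => //; exists i, e.
by move=> _ [[n /= Nn <-]] xu; exists n.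
Qed.

Definition in_omega (x : nat -> R) := forall i, omega_limit s (x i).

Lemma exists_in_omega : exists x : X, in_omega (il_coord x).
Proof.
have [x0 _] := il_inhabited.
(* Coordinate [i] of [f n] is [orb ((n - i) + (n + n))] for [i <= n], with an index beyond any
   bound, so a cluster point has all coordinates in the omega-limit set. *)
pose f n := branch_point s n (fun=> true) (orb (n + n)).
have Kf n : K (f n).
  by apply: branch_point_il => // k; apply: core_branches_true => //; exact: core_orb.
have [x hx] := il_cluster (fun n => insubd x0 (f n)).
exists x => i; apply/omega_limitP => e e0 N.
have [n nN xn] := hx i e e0 (maxn i N).
move: nN; rewrite geq_max => /andP[i_n Nn].
exists ((n - i) + (n + n))%N; first by rewrite addnA (leq_trans Nn)// leq_addl.
by rewrite orbD distrC; move: xn; rewrite il_insubdE// /f branch_point_le.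
Qed.

(** Without recurrence the orbit of [c] eventually keeps a distance [e] from [c]; points of the
    omega-limit set then keep at least [e / 2], and the factors [s ^+ k.+1] only help. *)
Lemma nonrecurrent_repelled (x : nat -> R) : ~ recurrent s -> in_omega x ->
  exists2 d, 0 < d & crit_repelled s 0 d x.
Proof.
move=> nrec ox.
have [e [e0 [N eN]]] : exists e, 0 < e /\ exists N, forall j, (N <= j)%N -> e <= `|orb j - c|.
  apply: contrapT => h; apply: nrec; apply/omega_limitP => e e0 N.
  apply: contrapT => h'; apply: h; exists e; split => //; exists N => j Nj.
  by rewrite leNgt; apply/negP => je; apply: h'; exists j.
exists (e / 2); first by rewrite divr_gt0.
move=> k; have e2 : 0 < e / 2 by rewrite divr_gt0.
have [j Nj jx] := (omega_limitP _).1 (ox (0 + k.+1)%N) _ e2 N.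
have := eN _ Nj; move: jx; rewrite (distrC (orb j)) => jx je.
have := ler_distD (x (0 + k.+1)%N) (orb j) c; rewrite (distrC (orb j) (x _)) => tri.
have ge1 : 1 <= s ^+ k.+1 by apply: exprn_ege1; exact/ltW/(slope_gt1 s_gt0 s_sq).
have : e / 2 <= `|x (0 + k.+1)%N - c| by lra.
by move=> h; apply: le_trans h _; rewrite ler_peMl.
Qed.

(** By the Lipschitz bound, the [k]-th pull-back contains the part [I k] of [[0, 1]] within
    [d / s ^+ k] of [x k]. If [c] were that close, it would be interior to the pull-back. *)
Lemma monotone_pullback_repelled l (x : nat -> R) d J : 0 < d ->
  omega_backward_orbit s l x ->
  is_monotone_pullback s l x (ball (x 0%N) d `&` `[0, 1]%classic) J ->
  forall k, (k < l)%N -> d <= s ^+ k.+1 * `|x k.+1 - c|.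
Proof.
move=> d0 [ox Tx] [[J0 HJ] mono].
pose I k : set R := [set y | 0 <= y <= 1 /\ `|y - x k| < d / s ^+ k].
have IJ k : (k <= l)%N -> I k `<=` J k.
  elim: k => [_ y [y01]|k IH kl].
    rewrite divr1 J0 => yx; split; last by rewrite /= in_itv.
    by rewrite -ball_normE/= distrC.
  have [_ _ _ maxJ] := HJ k kl; apply: maxJ.
  - split=> [y y' [/andP[y0 y1] yx] [/andP[y0' y1'] yx'] z /andP[yz zy]|y [y01 _]].
      split; first by rewrite (le_trans y0)//= (le_trans zy).
      by move: yx yx'; rewrite !ltr_norml => /andP[? ?] /andP[? ?]; apply/andP; split; lra.
    by rewrite /= in_itv.
  - have /omega_core ck := ox _ kl; split; last by rewrite subrr normr0 divr_gt0// slope_pow_gt0.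
    by rewrite (ltW (core_ge0 s_gt0 s_sq s_lt2 ck)) (ltW (core_lt1 s_gt0 s_lt2 ck)).
  - move=> _ [y [y01 yx] <-]; apply: IH (ltnW kl) _ _; split; first exact: tent_unit.
    rewrite -(Tx k kl); apply: le_lt_trans (tent_lip s_gt0 _ _) _.
    by move: yx; rewrite exprS invfM mulrCA -ltr_pdivlMl// mulrC.
move=> k kl; rewrite leNgt; apply/negP => h; apply: (mono k.+1 kl).
have {}h : `|x k.+1 - c| < d / s ^+ k.+1 by rewrite ltr_pdivlMr ?slope_pow_gt0// mulrC.
(* The bound [2^-1] keeps the ball around [c] inside [[0, 1]]. *)
pose r := Num.min 2^-1 (d / s ^+ k.+1 - `|x k.+1 - c|).
have r0 : 0 < r by rewrite lt_min subr_gt0 h invr_gt0 ltr0n.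
apply: filterS (nbhsx_ballx c r r0) => y; rewrite -ball_normE/= lt_min => /andP[yc yx].
apply: IJ => //; split.
  by move: yc; rewrite /crit ltr_norml => /andP[? ?]; apply/andP; split; lra.
rewrite (le_lt_trans (ler_distD c _ _))// -ltrBrDr (distrC c) (distrC y).
by move: yx; rewrite (distrC (x _)).
Qed.

(** The backward orbits of length [n], prolonged by right branches, are points of the compact
    inverse limit. Lying over the omega-limit set and being repelled with the common [d] are closed
    conditions on coordinates, so a cluster point inherits them. *)
Lemma reluctant_repelled : reluctantly_recurrent s ->
  exists2 x : X, in_omega (il_coord x) &
    exists2 d, 0 < d & crit_repelled s 0 d (il_coord x).
Proof.
move=> [_ [d d0 H]].
have {H}[xs Hxs] : exists xs : nat -> nat -> R, forall l,
    omega_backward_orbit s l (xs l) /\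
    forall k, (k < l)%N -> d <= s ^+ k.+1 * `|xs l k.+1 - c|.
  have : forall l, exists x : nat -> R, omega_backward_orbit s l x /\
    forall k, (k < l)%N -> d <= s ^+ k.+1 * `|x k.+1 - c|.
    move=> l; have [x ob [J mJ]] := H l; exists x; split => //.
    exact: monotone_pullback_repelled mJ.
  by move=> /choice[f ?]; exists f.
have [x0 _] := il_inhabited.
pose f n := branch_point s n (fun=> true) (xs n n).
have Kf n : K (f n).
  apply: branch_point_il => // k; apply: core_branches_true => //.
  by have [[ox _] _] := Hxs n; exact/omega_core/ox.
have fE n i : (i <= n)%N -> f n i = xs n i.
  move=> i_n; rewrite /f branch_point_le//; have [[_ Tx] _] := Hxs n.
  rewrite -[in RHS](subKn i_n); elim: (n - i)%N (leq_subr i n) => [|k IH] kn.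
    by rewrite subn0.
  have nk : (n - k.+1 < n)%N by rewrite ltn_subrL (leq_ltn_trans _ kn).
  by rewrite iterS IH ?(ltnW kn)// -(Tx _ nk) subnSK.
have [x hx] := il_cluster (fun n => insubd x0 (f n)).
have {}hx i e : 0 < e -> forall N, exists2 n, (N <= n)%N &
    (i <= n)%N /\ `|il_coord x i - xs n i| < e.
  move=> e0 N; have [n] := hx i e e0 (maxn i N).
  rewrite geq_max => /andP[i_n Nn]; rewrite il_insubdE// fE// => xn.
  by exists n.
exists x.
  move=> i; apply: omega_closure => e e0; have [n _ [i_n xn]] := hx i e e0 0%N.
  exists (xs n i); last by rewrite distrC.
  by have [[ox _] _] := Hxs n; exact: ox.
exists d => // k; apply/ler_addgt0Pr => e e0.
have [n _ [kn xn]] := hx (0 + k.+1)%N (e / s ^+ k.+1) (divr_gt0 e0 (slope_pow_gt0 s_gt0 _)) 0%N.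
have [_ /(_ k kn) dk] := Hxs n; apply: le_trans dk _.
have sk0 := slope_pow_gt0 s_gt0 k.+1.
have -> : s ^+ k.+1 * `|il_coord x (0 + k.+1)%N - c| + e =
    s ^+ k.+1 * (`|il_coord x (0 + k.+1)%N - c| + e / s ^+ k.+1).
  by rewrite mulrDr mulrCA divff ?mulr1// gt_eqF.
rewrite ler_pM2l// [leRHS]addrC.
apply: le_trans (ler_distD (il_coord x (0 + k.+1)%N) _ _) _.
by rewrite lerD2r distrC ltW.
Qed.

(** The union of all admissible intervals is again an interval, since they share the point
    [x k'.+1]; it is therefore the largest one. *)
Definition max_pullback (x : nat -> R) (J0 : set R) : nat -> set R :=
  fix J k := if k is k'.+1 then
    \bigcup_(I in [set I : set R | [/\ is_unit_subinterval I, I (x k'.+1) &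
                                   T @` I `<=` J k']]) I
  else J0.

Lemma max_pullbackP l (x : nat -> R) (J0 : set R) : J0 (x 0%N) ->
  (forall i, 0 <= x i <= 1) -> (forall i, T (x i.+1) = x i) ->
  is_pullback s l x J0 (max_pullback x J0).
Proof.
move=> J0x x01 Tx; split=> // k _; set J := max_pullback x J0.
have Jx k' : J k' (x k').
  elim: k' => //= k' IH; exists [set x k'.+1] => //; split=> //.
  - split=> [y y' -> -> z|y ->]; last by rewrite /= in_itv /=.
    by move=> /andP[h1 h2]; apply/eqP; rewrite eq_le h1 h2.
  - by move=> _ [_ -> <-]; rewrite Tx.
split; [split|exact: Jx| |].
- move=> y y' [I [[iI uI] Ix TI] Iy] [I' [[iI' uI'] Ix' TI'] Iy'] z /andP[yz zy].
  have [zx|/ltW xz] := leP z (x k.+1).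
    by exists I => //; apply: (iI y (x k.+1)) => //; rewrite yz.
  by exists I' => //; apply: (iI' (x k.+1) y') => //; rewrite xz.
- by move=> y [I [[_ uI] _ _] Iy]; exact: uI.
- by move=> _ [y [I [_ _ TI] Iy] <-]; apply: TI; exists y.
- by move=> I uI Ix TI y Iy; exists I.
Qed.

(** If a maximal pull-back along the shifted orbit [y] contained [c], it would contain the point [z]
    at distance [d / s ^+ k.+1] from [y k.+1] towards [c]. Going forward, this distance is
    multiplied by exactly [s] at each step and becomes [d], outside the open ball. *)
Lemma repelled_reluctant (x : X) n d : recurrent s -> 0 < d ->
  in_omega (il_coord x) -> crit_repelled s n d (il_coord x) ->
  reluctantly_recurrent s.
Proof.
move=> rec d0 ox xd; split=> //; exists d => // l.
pose y i := il_coord x (n + i)%N.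
have Ty i : T (y i.+1) = y i by rewrite /y addnS il_tent.
have cy i : core s (y i) by exact: il_coord_core.
have y01 i : 0 <= y i <= 1.
  by rewrite (ltW (core_ge0 s_gt0 s_sq s_lt2 (cy i))) (ltW (core_lt1 s_gt0 s_lt2 (cy i))).
exists y; first by split=> i _; [exact: ox|exact: Ty].
set J0 := _ `&` _; exists (max_pullback y J0).
have J0y : J0 (y 0%N) by split; [exact: ballxx|rewrite /= in_itv; exact: y01].
split; first exact: max_pullbackP.
case=> [|k] // _ /interior_subset Jc.
set J := max_pullback y J0 in Jc.
have [_ HJ] := max_pullbackP k.+1 J0y y01 Ty.
have [[iJ _] Jy _ _] := HJ k (ltnSn k).
have kd := xd k; rewrite -/(y k.+1) in kd.
(* The direction from [y k.+1] to [c]. *)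
pose e := if y k.+1 <= c then 1 else - 1 : R.
pose z := y k.+1 + e * (d / s ^+ k.+1).
have sk0 := slope_pow_gt0 s_gt0 k.+1.
have dk : d / s ^+ k.+1 <= `|y k.+1 - c| by rewrite ler_pdivrMr// mulrC.
have dk0 : 0 < d / s ^+ k.+1 by rewrite divr_gt0.
have Jz : J k.+1 z.
  rewrite /z /e; move: dk; case: (leP (y k.+1) c) => yc.
    rewrite ler0_norm ?subr_le0// mul1r => dk.
    by apply: (iJ _ _ Jy Jc); apply/andP; split; lra.
  rewrite gtr0_norm ?subr_gt0// mulN1r => dk.
  by apply: (iJ _ _ Jc Jy); apply/andP; split; lra.
have zy : `|z - y k.+1| = d / s ^+ k.+1.
  rewrite /z addrAC subrr add0r normrM (gtr0_norm dk0) /e.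
  by case: ifP => _; rewrite ?normrN normr1 mul1r.
have step j : (j <= k.+1)%N ->
    J (k.+1 - j)%N (iter j T z) /\ `|iter j T z - y (k.+1 - j)%N| = d / s ^+ (k.+1 - j).
  elim: j => [|j IH] jk; first by rewrite subn0.
  have [Jj yj] := IH (ltnW jk); have sj : (k.+1 - j = (k.+1 - j.+1).+1)%N by rewrite subnSK.
  rewrite sj in Jj yj; set m := (k.+1 - j.+1)%N in Jj yj *.
  have mk : (m < k.+1)%N by rewrite /m ltn_subrL.
  have [_ _ TJ _] := HJ m mk; split; first by apply: TJ; exists (iter j T z).
  rewrite iterS -(Ty m) tent_expand// ?yj.
    by rewrite exprS invfM mulrCA mulVKf// gt_eqF.
  by rewrite ler_pdivrMr ?slope_pow_gt0// mulrC; exact: (xd m).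
have [] := step k.+1 (leqnn _); rewrite subnn expr0 divr1 => -[+ _].
by rewrite -ball_normE/= distrC => + h; rewrite h ltxx.
Qed.

End recurrence.

(** * The tent map is locally eventually onto *)

Lemma within_continuous_nbhs (S S' : topologicalType) (U : set S) (f : S -> S') y :
  {within U, continuous f} -> nbhs y U -> f @ y --> f y.
Proof.
move=> /subspace_continuousP cf Uy A Afy.
have := cf y (nbhs_singleton Uy) A Afy; rewrite /= /within/=.
by move: Uy; apply: filterS2 => z Uz; exact.
Qed.

(** The Cantor space is totally disconnected; an arc in a product neighbourhood therefore has a
    constant Cantor coordinate. *)
Lemma connected_cantor_const (S : topologicalType) (A : set S) (h : S -> cantor_space) :
  connected A -> {within A, continuous h} -> forall a b, A a -> A b -> h a = h b.
Proof.
move=> cA ch a b Aa Ab.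
have := @zero_dimension_totally_disconnected cantor_space cantor_zero_dimensional (h b) I.
move=> tdc; have : connected_component [set: cantor_space] (h b) (h a).
  have hAb : (h @` A) (h b) by exists b.
  have hAc : connected (h @` A) by exact: connected_continuous_connected.
  by apply: (connected_component_max hAb (@subsetT _ _) hAc); exists a.
by rewrite tdc.
Qed.

Section locally_eventually_onto.
Context (R : realType) (s : R).
Hypotheses (s_gt0 : 0 < s) (s_sq : 2 < s ^+ 2) (s_lt2 : s < 2).

Local Notation T := (tent s).
Local Notation c := (crit R).
Local Notation orb := (crit_orbit s).

Definition covered (k : nat) (a b y : R) := exists2 u, a <= u <= b & iter k T u = y.

Lemma covered_left (a b y : R) : b <= c -> s * a <= y <= s * b -> covered 1 a b y.
Proof.
move=> bc /andP[ay yb]; have ub : y / s <= b by rewrite ler_pdivrMr// mulrC.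
exists (y / s); first by rewrite ub ler_pdivlMr// mulrC ay.
by rewrite /= tent_left ?(le_trans ub)// mulrC divfK// gt_eqF.
Qed.

Lemma covered_right (a b y : R) : c <= a -> s * (1 - b) <= y <= s * (1 - a) ->
  covered 1 a b y.
Proof.
move=> ca /andP[yb ya]; have s0 : s != 0 by rewrite gt_eqF.
have au : a <= 1 - y / s by rewrite lerBrDl -lerBrDr ler_pdivrMr// mulrC.
exists (1 - y / s); first by rewrite au lerBlDl -lerBlDr ler_pdivlMr// mulrC.
by rewrite /= tent_right ?(le_trans ca)//; field.
Qed.

(* One or two iterates either stretch an interval by [s^2 / 2 > 1] or produce
   an interval containing both [c] and [c_1], whose image is the whole core. *)
Lemma interval_stretch (a b : R) : core s a -> core s b -> a < b ->
  exists k, (forall y, core s y -> covered k a b y) \/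
    exists a' b', [/\ core s a', core s b', a' < b',
      s ^+ 2 / 2 * (b - a) <= b' - a' &
      forall y, a' <= y <= b' -> covered k a b y].
Proof.
move=> ca cb ab; have s1 := slope_gt1 s_gt0 s_sq.
have ss : s ^+ 2 / 2 <= s by rewrite expr2; move: s_gt0 s_lt2 => h1 h2; nra.
have [bc|cb'] := leP b c.
  exists 1%N; right; exists (T a), (T b).
  have [Ta Tb] := (tent_left s_gt0 (le_trans (ltW ab) bc), tent_left s_gt0 bc).
  split; [exact: core_tent|exact: core_tent| | |].
  - by rewrite Ta Tb ltr_pM2l.
  - by rewrite Ta Tb -mulrBr ler_wpM2r// subr_ge0 ltW.
  - by move=> y; rewrite Ta Tb; exact: covered_left.
have [ac|ac] := leP c a.
  exists 1%N; right; exists (T b), (T a).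
  have [Ta Tb] := (tent_right s_gt0 ac, tent_right s_gt0 (ltW cb')).
  split; [exact: core_tent|exact: core_tent| | |].
  - by rewrite Ta Tb ltr_pM2l// ltrD2l ltrN2.
  - rewrite Ta Tb -mulrBr; have -> : 1 - a - (1 - b) = b - a by ring.
    by rewrite ler_wpM2r// subr_ge0 ltW.
  - by move=> y; rewrite Ta Tb; exact: covered_right.
(* Here [c] is inside. The longer of [[a, c]] and [[c, b]] has at least half the length, and its
   image runs from the smaller endpoint value up to [c_1]. *)
have cabs : s * (b - a) / 2 <= orb 1 - Num.min (T a) (T b).
  rewrite (tent_left s_gt0 (ltW ac)) (tent_right s_gt0 (ltW cb')) orb1//.
  rewrite /crit in ac cb'; rewrite /Num.min; case: ifP => h.
    by move: s_gt0 h => h0 h; nra.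
  by move: s_gt0 h => h0 /negbT; rewrite -leNgt => h; nra.
set m := Num.min _ _ in cabs; exists 2%N.
have cov1 y : m <= y <= orb 1 -> covered 1 a b y.
  move=> /andP[my y1]; have := my; rewrite /m ge_min => /orP[Ty|Ty].
    have [|u /andP[au uc] Tu] := @covered_left a c y (lexx _).
      by rewrite -(tent_left s_gt0 (ltW ac)) Ty -(tent_left s_gt0 (lexx c)).
    by exists u => //; rewrite au (le_trans uc)// ltW.
  have [|u /andP[au uc] Tu] := @covered_right c b y (lexx _).
    by rewrite -(tent_right s_gt0 (ltW cb')) Ty -(tent_right s_gt0 (lexx c)).
  by exists u => //; rewrite uc andbT (le_trans _ au)// ltW.
have cov2 p y : c <= p -> m <= p -> orb 2 <= y <= T p -> covered 2 a b y.
  move=> cp mp y2; have [|u /andP[pu u1] Tu] := @covered_right p (orb 1) y cp.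
    have c1 := ltW (crit_lt_orb1 s_gt0 s_sq).
    by rewrite -(tent_right s_gt0 c1) -(tent_right s_gt0 cp).
  have [|v vab Tv] := cov1 u; first by rewrite (le_trans mp).
  by exists v => //; rewrite iterS Tv.
have [mc|cm] := leP m c.
  left=> y /coreP y2; exact: cov2 (lexx _) mc _.
right; exists (orb 2), (T m).
have m1 : m <= orb 1 by rewrite /m ge_min tent_le_orb1.
have big : s ^+ 2 / 2 * (b - a) <= T m - orb 2.
  have c1 := ltW (crit_lt_orb1 s_gt0 s_sq).
  rewrite (tent_right s_gt0 (ltW cm)) (orbS s 1) (tent_right s_gt0 c1).
  have -> : s * (1 - m) - s * (1 - orb 1) = s * (orb 1 - m) by ring.
  have -> : s ^+ 2 / 2 * (b - a) = s * (s * (b - a) / 2) by field.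
  by rewrite ler_pM2l.
split=> //; [exact: core_orb| | |].
- by apply: core_tent_right => //; rewrite (ltW cm).
- rewrite -subr_gt0; apply: lt_le_trans big; rewrite mulr_gt0 ?subr_gt0//.
  by rewrite divr_gt0// exprn_gt0.
- by move=> y; exact: cov2 (ltW cm) (lexx _).
Qed.

(** Each stretching multiplies the length by at least [s ^+ 2 / 2 > 1], but lengths in the core stay
    below [1], so some image is the whole core. Later images remain so, because every core point has
    its right preimage in the core. *)
Lemma core_covered (a b : R) : core s a -> core s b -> a < b ->
  exists k, forall m, (k <= m)%N -> forall y, core s y -> covered m a b y.
Proof.
move=> ca cb ab.
suff [k hk] : exists k, forall y, core s y -> covered k a b y.
  exists k => m km; rewrite -(subnK km); elim: (m - k)%N => [|j IH] y cy; first exact: hk.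
  have [u uab Tu] := IH _ (core_branch_true s_gt0 s_sq cy).
  exists u => //; rewrite addSn iterS Tu tent_branch//.
  by have /coreP/andP[] := cy.
have [n] : exists n, 1 / (b - a) < (s ^+ 2 / 2) ^+ n.
  by apply: pow_unbounded; rewrite ltr_pdivlMr// mul1r.
rewrite ltr_pdivrMr ?subr_gt0//.
elim: n a b ca cb ab => [|n IH] a b ca cb ab.
  rewrite mul1r => h; exfalso; move: h; apply/negP; rewrite -leNgt.
  by have := core_lt1 s_gt0 s_lt2 cb; have := core_ge0 s_gt0 s_sq s_lt2 ca; lra.
move=> h; have [k [|[a' [b' [ca' cb' ab' len cov]]]]] := interval_stretch ca cb ab.
  by exists k.
have [|j hj] := IH a' b' ca' cb' ab'.
  apply: lt_le_trans h _; rewrite exprSr -mulrA ler_wpM2l// exprn_ge0//.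
  by rewrite divr_ge0// exprn_ge0// ltW.
exists (j + k)%N => y /hj[u /cov[v vab Tv] Tu].
by exists v => //; rewrite iterD Tv.
Qed.

End locally_eventually_onto.

(** * Endpoints are folding points *)

Section endpoints_fold.
Context (R : realType) (s : R).
Local Notation X := (core_inverse_limit s).

(** In a product neighbourhood, the interval fibre through [x] gives two incomparable arcs, on
    either side of [x]. *)
Lemma endpoint_folding (x : X) : endpoints s x -> folding_points s x.
Proof.
move=> ex [U Ux [f [g [fU gV cf cg [gf fg]]]]].
have Uxx := nbhs_singleton Ux; have := fU x Uxx; have := gf x Uxx.
case: (f x) => k0 t0 gx [_ /=]; rewrite in_itv/= => /andP[t00 t01].
pose path t := g (k0, t).
have cpath : {within `]0, 1[%classic, continuous path}.
  apply/subspace_continuousP => t t_in A Ag.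
  move/subspace_continuousP: cg => /(_ (k0, t) (conj Logic.I t_in) A Ag).
  rewrite /= /within/= => h.
  have : nbhs t (fun u => @cantor_times_interval R (k0, u) -> A (g (k0, u))).
    have cp : (k0, u) @[u --> t] --> (k0, t).
      by apply: (@cvg_pair _ _ _ _ (nbhs k0) (nbhs t)); [exact: cvg_cst|exact: cvg_id].
    exact: (cp _ h).
  by apply: filterS => u hu u_in; apply: hu.
pose e := Num.min t0 (1 - t0) / 2.
have e0 : 0 < e by rewrite divr_gt0// lt_min t00 subr_gt0.
have [e1 e2] : e < t0 /\ e < 1 - t0.
  have h1 : Num.min t0 (1 - t0) <= t0 by rewrite ge_min lexx.
  have h2 : Num.min t0 (1 - t0) <= 1 - t0 by rewrite ge_min lexx orbT.
  by move: e0; rewrite /e; split; lra.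
have sub a b : a <= b -> 0 < a -> b < 1 -> subcontinuum (path @` `[a, b]%classic).
  move=> ab a0 b1.
  have cab : {within `[a, b]%classic, continuous path}.
    apply: continuous_subspaceW cpath => t /=; rewrite !in_itv/= => /andP[at_ tb].
    by rewrite (lt_le_trans a0 at_) (le_lt_trans tb b1).
  split.
  - by exists (path a), a => //=; rewrite in_itv/= lexx.
  - by apply: continuous_compact => //; exact: segment_compact.
  - apply: connected_continuous_connected => //.
    by apply/connected_intervalP; exact: interval_is_interval.
have inj t u : 0 < t < 1 -> 0 < u < 1 -> path t = path u -> t = u.
  move=> t_in u_in /(congr1 f); rewrite !fg; first by case.
    by split => //=; rewrite in_itv.
  by split => //=; rewrite in_itv.
have s1 : subcontinuum (path @` `[t0 - e, t0]%classic) by apply: sub; lra.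
have s2 : subcontinuum (path @` `[t0, t0 + e]%classic) by apply: sub; lra.
have [||AB|BA] := ex _ _ s1 s2.
- by exists t0 => //=; rewrite in_itv/=; lra.
- by exists t0 => //=; rewrite in_itv/=; lra.
- have [|u /=] := AB (path (t0 - e)); first by exists (t0 - e) => //=; rewrite in_itv/=; lra.
  rewrite in_itv/= => h hu; have uE : u = t0 - e by apply: inj hu; lra.
  by move: h; rewrite uE; lra.
- have [|u /=] := BA (path (t0 + e)); first by exists (t0 + e) => //=; rewrite in_itv/=; lra.
  rewrite in_itv/= => h hu; have uE : u = t0 + e by apply: inj hu; lra.
  by move: h; rewrite uE; lra.
Qed.

End endpoints_fold.

(** * Points over the omega-limit set are folding points *)

(** Continuous induction: where the weak bound has held so far, it improves to the strict one, so
    continuity carries it past the supremum of the good times. *)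
Lemma real_induction_lt (R : realType) (h : R -> R) (b e : R) :
  0 <= e -> continuous h ->
  (forall t, 0 <= t <= e -> (forall u, 0 <= u <= t -> h u <= b) -> h t < b) ->
  h 0 < b -> forall t, 0 <= t <= e -> h t < b.
Proof.
move=> e0 ch step h0.
pose S := [set t | 0 <= t <= e /\ forall u, 0 <= u <= t -> h u < b].
have S0 : S 0.
  split=> [|u u0]; first by rewrite lexx.
  by rewrite (_ : u = 0)//; apply/eqP; rewrite eq_le andbC.
have hS : has_sup S by split; [exists 0|exists e => t [/andP[_]]].
have ub := sup_upper_bound hS.
set m := sup S in ub.
have m0 : 0 <= m by exact: ub.
have me : m <= e by apply: ge_sup; [exists 0|move=> t [/andP[_]]].
have below u : 0 <= u -> u < m -> h u < b.
  move=> u0 um; have mu : 0 < m - u by rewrite subr_gt0.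
  have [t [_ tS]] := sup_adherent mu hS; rewrite -/m subKr => ut.
  by apply: tS; rewrite u0 /= ltW.
have hm : h m <= b.
  rewrite leNgt; apply/negP => bm.
  have /nbhs_ballP[r /= r0 rh] : \forall u \near m, b < h u by exact: (cvgr_gt (h m) (ch m)).
  have [t [tS1 tS2]] := sup_adherent r0 hS; rewrite -/m => mt.
  have tm : t <= m by exact: ub.
  have : b < h t.
    by apply: rh; rewrite -ball_normE/= ger0_norm ?subr_ge0//; lra.
  by move=> /lt_trans; have /andP[t0 _] := tS1; move=> /(_ _ (tS2 t _)); rewrite t0 lexx ltxx => /(_ isT).
have hmb : h m < b.
  apply: step; first by rewrite m0.
  move=> u /andP[u0]; rewrite le_eqVlt => /predU1P[->//|um]; exact/ltW/below.
have {me} em : m = e.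
  apply/eqP; rewrite eq_le me leNgt; apply/negP => {}me.
  have /nbhs_ballP[r /= r0 rh] : \forall u \near m, h u < b by exact: (cvgr_lt (h m) (ch m)).
  pose m' := Num.min e (m + r / 2).
  have mm' : m < m' by rewrite lt_min me ltrDl divr_gt0.
  suff /ub : S m' by rewrite leNgt mm'.
  split; first by rewrite (le_trans m0 (ltW mm')) ge_min lexx.
  move=> u /andP[u0 um']; have [um|mu] := ltP u m; first exact: below.
  apply: rh; rewrite -ball_normE/= distrC ger0_norm ?subr_ge0//.
  by move: um'; rewrite le_min => /andP[_]; lra.
move=> t /andP[t0]; rewrite -em le_eqVlt => /predU1P[->//|]; exact: below.
Qed.

(** Stated as a pair of Boolean facts so that it can be used as a rewriting multirule. *)
Lemma dist_between (R : realDomainType) (a z b : R) : a <= z -> z <= b ->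
  (`|z - a| <= `|b - a|) * (`|z - b| <= `|b - a|).
Proof.
move=> az zb; rewrite (distrC z b) !ger0_norm ?subr_ge0 ?(le_trans az zb)//.
by rewrite lerD2r zb lerD2l lerN2 az.
Qed.

Section folding_of_omega.
Context (R : realType) (s : R).
Hypotheses (s_gt0 : 0 < s) (s_sq : 2 < s ^+ 2) (s_lt2 : s < 2).

Local Notation T := (tent s).
Local Notation c := (crit R).
Local Notation orb := (crit_orbit s).
Local Notation X := (core_inverse_limit s).
Local Notation K := (core_inverse_limit_set s).

Lemma compact_coord_ball (x : X) n (d : R) :
  compact [set y : X | `|il_coord x n - il_coord y n| <= d].
Proof.
apply: (subclosed_compact _ (compact_il s_gt0 s_sq s_lt2)) => //.
rewrite (_ : [set y | _] = (fun y : X => il_coord y n) @^-1`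
    `[il_coord x n - d, il_coord x n + d]).
  by apply: preimage_closed (@itv_closed _ _ _ _) => y _; exact: continuous_il_coord.
apply/seteqP; split=> y /=; rewrite in_itv/= ler_distlC.
  by move=> /andP[? ?]; apply/andP; split; lra.
by move=> /andP[? ?]; apply/andP; split; lra.
Qed.

(** Compactness of [Q] times [Q]: near the diagonal [h] is continuous, and near a pair differing at
    index [i] no two points agree at an index [m >= i]. *)
Lemma coord_modulus (Q : set X) (h : X -> R) (e : R) : 0 < e -> compact Q ->
  (forall y, Q y -> h @ y --> h y) ->
  exists n, forall m, (n <= m)%N -> forall a b, Q a -> Q b ->
    il_coord a m = il_coord b m -> `|h a - h b| < e.
Proof.
move=> e0 cQ ch; have e2 : 0 < e / 2 by rewrite divr_gt0.
have /compact_near_coveringP := compact_setX cQ cQ.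
move=> /(_ nat \oo (fun m ab => il_coord ab.1 m = il_coord ab.2 m ->
  `|h ab.1 - h ab.2| < e) _) [].
  move=> [a b] [/= Qa Qb]; have [<-{b Qb}|ab] := pselect (a = b).
    have /nbhs_ballP[r /= r0 hr] : nbhs a (fun y => `|h a - h y| < e / 2).
      by move/(@cvgrPdist_lt _ R^o) : (ch a Qa); exact.
    exists ([set ab : X * X | ball a r ab.1 /\ ball a r ab.2], setT).
      split; last exact: filterT.
      by exists (ball a r, ball a r) => //=; split; exact: nbhsx_ballx.
    move=> [[a' b'] m] /= [[/hr aa' /hr ab'] _] _.
    by rewrite (le_lt_trans (ler_distD (h a) _ _))// distrC [ltRHS]splitr ltrD.
  have [i abi] : exists i, il_coord a i != il_coord b i.
    apply: contrapT => nab; apply: ab; apply: il_ext => i; apply/eqP.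
    by apply: contrapT => h'; apply: nab; exists i; exact/negP.
  pose r := `|il_coord a i - il_coord b i| / 2.
  have r0 : 0 < r by rewrite divr_gt0// normr_gt0 subr_eq0.
  exists ([set ab : X * X | `|il_coord a i - il_coord ab.1 i| < r /\
     `|il_coord b i - il_coord ab.2 i| < r], [set m | (i <= m)%N]).
    split; last by exists i.
    exists ([set y : X | `|il_coord a i - il_coord y i| < r],
            [set y : X | `|il_coord b i - il_coord y i| < r]) => //=.
    by split; apply/nbhs_ilP => //; exists i, r.
  move=> [[a' b'] m] /= [[aa' bb'] im] a'b'; exfalso.
  move: bb' aa'; rewrite -(il_coord_eq_le im a'b').
  have := ler_distD (il_coord a' i) (il_coord a i) (il_coord b i).
  rewrite (distrC (il_coord a' i) (il_coord b i)) => tri h1 h2.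
  have : `|il_coord a i - il_coord b i| < r + r by lra.
  by rewrite /r -splitr ltxx.
move=> n _ hn; exists n => m nm a b Qa Qb; exact: (hn m nm (a, b)).
Qed.

Lemma in_omega_folding (x : X) : in_omega s (il_coord x) -> folding_points s x.
Proof.
move=> ox [U Ux [f [g [fU gV cf cg [gf fg]]]]].
have Oc y : U° y -> f @ y --> f y by exact: within_continuous_nbhs cf.
have c1 := crit_lt_orb1 s_gt0 s_sq; have c2 := orb2_lt_crit s_gt0 s_sq.
(* Half the length of the core: no open interval of radius [r0] contains both [c_1] and [c_2], which
   is the final contradiction. *)
pose r0 := (orb 1 - orb 2) / 2.
have r00 : 0 < r0 by rewrite divr_gt0// subr_gt0 (lt_trans c2).
have : nbhs x (U° `&` [set y : X | `|il_coord x 0 - il_coord y 0| < r0]).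
  apply: filterI; first exact: nbhs_interior.
  by apply/nbhs_ilP => //; exists 0%N, r0.
move=> /(nbhs_ilP s_gt0 s_sq s_lt2)[n [d d0 dO]].
pose Q := [set y : X | `|il_coord x n - il_coord y n| <= d / 2].
have QO y : Q y -> U° y /\ `|il_coord x 0 - il_coord y 0| < r0.
  by move=> Qy; apply: dO; apply: le_lt_trans Qy _; rewrite ltr_pdivrMr//; lra.
have Qx : Q x by rewrite /Q /= subrr normr0 divr_ge0// ltW.
have Qf y : Q y -> f @ y --> f y by move=> /QO[/Oc].
have QU y : Q y -> U y by move=> /QO[/interior_subset].
have d2 : 0 < d / 2 by rewrite divr_gt0.
pose Qi := [set y : X | `|il_coord x n - il_coord y n| < d / 2].
have nQi : nbhs x Qi by apply/nbhs_ilP => //; exists n, (d / 2).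
(* A product box around [f x] that [g] sends into the open slab [Qi]. *)
have [A [e [e0 [nA box]]]] : exists (A : set cantor_space) (e : R), 0 < e /\ (nbhs (f x).1 A /\
    forall k t, A k -> `|(f x).2 - t| < e -> @cantor_times_interval R (k, t) -> Qi (g (k, t))).
  have nQi' : nbhs (g (f x)) Qi by rewrite gf//; exact: QU.
  move/subspace_continuousP: cg => /(_ (f x) (fU _ (QU _ Qx)) Qi nQi'); rewrite /= /within/= => -[[A B] /= [nA /nbhs_ballP[e /= e0 eB]] AB].
  exists A, e; split => //; split => // k t Ak te VV.
  by apply: (AB (k, t)) => //; split => //; apply: eB; rewrite -ball_normE.
have e2 : 0 < e / 2 by rewrite divr_gt0.
have cf2 y : Q y -> (fun y => (f y).2) @ y --> (f y).2.
  by move=> Qy; apply: cvg_comp (Qf y Qy) _; exact: cvg_snd.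
have [n0 hn0] := @coord_modulus Q (fun y => (f y).2) _ e2 (@compact_coord_ball x n (d / 2)) cf2.
have : nbhs x (fun y => A (f y).1 /\ `|(f x).2 - (f y).2| < e / 2 /\ Qi y).
  have h1 : nbhs x (fun y => A (f y).1).
    by apply: (cvg_comp _ _ (Qf x Qx) (@cvg_fst _ _ _ _ _)).
  have h2 : nbhs x (fun y => `|(f x).2 - (f y).2| < e / 2).
    by move/(@cvgrPdist_lt _ R^o) : (cf2 x Qx); exact.
  by apply: filterS2 nQi (filterI h1 h2) => y ? [].
move=> /(nbhs_ilP s_gt0 s_sq s_lt2)[n1 [d1 d10 hd1]].
pose eta := Num.min (orb 1 - c) (c - orb 2).
have eta0 : 0 < eta by rewrite lt_min !subr_gt0 c1.
have [eta1 eta2] : eta <= orb 1 - c /\ eta <= c - orb 2.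
  by split; rewrite ge_min lexx ?orbT.
have ceta t : `|t| <= eta -> core s (c + t).
  by rewrite ler_norml => /andP[h1 h2]; apply/coreP/andP; split; lra.
have ce : core s (c + eta) by apply: ceta; rewrite gtr0_norm.
have cce : c < c + eta by rewrite ltrDl.
have [M0 hM0] := core_covered s_gt0 s_sq s_lt2 (core_crit s_gt0 s_sq) ce cce.
(* The index [j] puts [orb j] so close to [x_m] that the point over [c] at level [m + j] is near [x]
   at coordinate [n1]. Moreover [j >= 1] makes the arc over [c] fold at level [m], and [j >= M0]
   makes its projection to coordinate [0] cover the core. *)
have [j] := (omega_limitP _ _).1 (ox (maxn n (maxn n0 n1))) _
  (divr_gt0 d10 (slope_pow_gt0 s_gt0 (maxn n (maxn n0 n1) - n1))) (maxn M0 1).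
set m := maxn n (maxn n0 n1); rewrite geq_max => /andP[M0j j0].
rewrite ltr_pdivlMr ?slope_pow_gt0// mulrC => cj.
have [nm [n0m n1m]] : (n <= m /\ n0 <= m /\ n1 <= m)%N.
  by rewrite /m !leq_max !leqnn !orbT.
pose M := (m + j)%N.
pose w t := insubd x (branch_point s M (fun=> true) (c + t)).
have Kw t : `|t| <= eta -> K (branch_point s M (fun=> true) (c + t)).
  by move=> te; apply: branch_point_il => // k; apply: core_branches_true => //; exact: ceta.
have w_coord t i : `|t| <= eta -> (i <= M)%N -> il_coord (w t) i = iter (M - i) T (c + t).
  by move=> te iM; rewrite /w il_insubdE ?branch_point_le//; exact: Kw.
have norm0 : `|0 : R| <= eta by rewrite normr0 ltW.
have mM : (m <= M)%N by rewrite leq_addr.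
have [Aw0 [tw0 Qw0]] : A (f (w 0)).1 /\ `|(f x).2 - (f (w 0)).2| < e / 2 /\ Qi (w 0).
  apply: hd1; rewrite (il_iterE x n1m) (il_iterE (w 0) n1m).
  apply: le_lt_trans (iter_tent_lip s_gt0 _ _ _) _.
  by rewrite w_coord// addr0 /M addKn -/(orb j) distrC.
(* The larger deviation from [x], at coordinate [n], of the two ends [w t] and [w (- t)]. *)
pose h t := Num.max `|il_coord x n - iter (M - n) T (c + t)| `|il_coord x n - iter (M - n) T (c - t)|.
have nM : (n <= M)%N by exact: leq_trans nm mM.
have ch : continuous h.
  have cdist (p : R -> R) : continuous p ->
      continuous (fun t => `|il_coord x n - iter (M - n) T (p t)| : R^o).
    move=> cp t; apply: (@cvg_norm R R^o).
    apply: (@cvgB R R^o _ (nbhs t) _ (fun=> il_coord x n)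
      (fun t => iter (M - n) T (p t))); first exact: cvg_cst.
    apply: (@cvg_comp _ _ _ p (iter (M - n) T) _ (nbhs (p t))); first exact: cp.
    exact: continuous_iter_tent.
  move=> t; apply: (@continuous_max R R (fun t => `|il_coord x n - iter (M - n) T (c + t)|)
     (fun t => `|il_coord x n - iter (M - n) T (c - t)|)); apply: cdist => {}t.
    by apply: (@cvgD R R^o); [exact: cvg_cst|exact: cvg_id].
  by apply: (@cvgB R R^o); [exact: cvg_cst|exact: cvg_id].
have hQ b t : 0 <= t <= eta -> h t <= b ->
    `|il_coord x n - il_coord (w t) n| <= b /\ `|il_coord x n - il_coord (w (- t)) n| <= b.
  move=> /andP[t0 te]; rewrite ge_max => /andP[h1 h2].
  by rewrite !w_coord// ?normrN ger0_norm.
have Qh u t : `|u| <= t -> t <= eta -> (forall v, 0 <= v <= t -> h v <= d / 2) -> Q (w u).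
  move=> ut te ht; have := ht `|u|; rewrite normr_ge0 ut => /(_ isT).
  move=> /hQ; rewrite normr_ge0 (le_trans ut te) => /(_ isT).
  by have [u0|u0] := leP 0 u; [rewrite (ger0_norm u0)|rewrite (ltr0_norm u0) opprK] => -[].
(* As long as the arc stays in the closed slab [Q], its ends are in fact in the open slab [Qi]. *)
have step t : 0 <= t <= eta -> (forall u, 0 <= u <= t -> h u <= d / 2) -> h t < d / 2.
  move=> /andP[t0 te] ht.
  have Qw u : `|u| <= t -> Q (w u) by move=> ut; exact: Qh ut te ht.
  have in_t u : u \in `[- t, t] -> `|u| <= t by rewrite in_itv/= ler_norml.
  have cw : {within `[- t, t]%classic, continuous (fun u => f (w u))}.
    apply/subspace_continuousP => u /= /in_t ut.
    apply: cvg_comp (Qf _ (Qw u ut)); apply: cvg_il => // i.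
    rewrite il_insubdE; last by apply: Kw; exact: le_trans te.
    apply: (@cvg_trans _ ((fun v => branch_point s M (fun=> true) (c + v) i) @ within `[- t, t]%classic (nbhs u))).
      apply: near_eq_cvg; near=> v; rewrite /w il_insubdE//.
      apply: Kw; apply: le_trans te; apply: in_t.
      by near: v; exact: withinT.
    apply: cvg_within_filter.
    apply: (@cvg_comp _ _ _ (fun v => c + v) (fun v => branch_point s M (fun=> true) v i)); last first.
      exact: continuous_branch_point.
    by apply: (@cvgD R R^o); [exact: cvg_cst|exact: cvg_id].
  have cw1 : {within `[- t, t]%classic, continuous (fun u => (f (w u)).1)}.
    apply/subspace_continuousP => u /= ut; move/subspace_continuousP: cw => /(_ u ut) cwu.
    by apply: (cvg_comp _ _ cwu); exact: cvg_fst.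
  have cw2 : {within `[- t, t]%classic, continuous (fun u => (f (w u)).2)}.
    apply/subspace_continuousP => u /= ut; move/subspace_continuousP: cw => /(_ u ut) cwu.
    by apply: (cvg_comp _ _ cwu); exact: cvg_snd.
  have const u v : u \in `[- t, t] -> v \in `[- t, t] -> (f (w u)).1 = (f (w v)).1.
    move=> ut vt; apply: (connected_cantor_const _ cw1) => //.
    by apply/connected_intervalP; exact: interval_is_interval.
  (* The Cantor coordinate being constant, the interval coordinate determines [w u], hence its
     coordinate [c + u] at level [M]. *)
  have inj : {in `[- t, t] &, injective (fun u => (f (w u)).2)}.
    move=> u v ut vt /= uv2.
    have uv : f (w u) = f (w v).
      rewrite (surjective_pairing (f (w u))) (surjective_pairing (f (w v))).
      by rewrite uv2 (const u v).
    have : w u = w v.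
      by rewrite -(gf (w u)) ?uv ?gf//; apply/QU/Qw/in_t.
    move=> /(congr1 (fun y => il_coord y M)).
    by rewrite !w_coord ?subnn// ?(le_trans (in_t _ _) te)//; exact: addrI.
  have t_in : t \in `[- t, t] by rewrite in_itv/= lexx andbT; lra.
  have nt_in : - t \in `[- t, t] by rewrite in_itv/= lexx; lra.
  have z_in : 0 \in `[- t, t] by rewrite in_itv/= oppr_le0 t0.
  (* By symmetry about [c] both ends agree at index [m >= n0]. *)
  have close : `|(f (w t)).2 - (f (w (- t))).2| < e / 2.
    apply: (hn0 m n0m); [exact/Qw/in_t|exact/Qw/in_t|].
    rewrite !w_coord ?(le_trans (in_t _ _) te)// /M addKn.
    by case: (j) j0 => // i _; rewrite iter_tent_symm.
  have mono : {in `[- t, t] &, {homo (fun u => (f (w u)).2) : u v / u <= v}} \/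
              {in `[- t, t] &, {homo (fun u => (f (w u)).2) : u v /~ u <= v}}.
    case: (itv_continuous_inj_mono cw2 inj) => mono; [left|right] => u v ut vt /=;
      by rewrite le_eqVlt => /predU1P[->//|uv]; apply/ltW/mono.
  (* By monotonicity the interval coordinate of [w 0] lies between those of the ends, so each end is
     within [e / 2] of it and thus within [e] of that of [x]; the box applies. *)
  have near0 u : u = t \/ u = - t -> Qi (w u).
    move=> ut; have u_in : u \in `[- t, t] by case: ut => ->.
    have VV := fU _ (QU _ (Qw _ (in_t _ u_in))).
    have fwu : f (w u) = ((f (w u)).1, (f (w u)).2) by case: (f (w u)).
    rewrite -(gf (w u)); last exact/QU/Qw/in_t.
    rewrite fwu; apply: box; [by rewrite (const u 0)| |by rewrite -fwu].
    rewrite (le_lt_trans (ler_distD (f (w 0)).2 _ _))// [ltRHS]splitr ltrD//.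
    apply: le_lt_trans close; have le_nt : - t <= 0 by rewrite oppr_le0.
    case: mono => mono.
      have h1 := mono _ _ z_in t_in t0; have h2 := mono _ _ nt_in z_in le_nt.
      by case: ut => ->; rewrite (dist_between h2 h1).
    have h1 := mono _ _ t_in z_in t0; have h2 := mono _ _ z_in nt_in le_nt.
    by rewrite (distrC (f (w t)).2); case: ut => ->; rewrite (dist_between h1 h2).
  have := near0 t (or_introl erefl); have := near0 (- t) (or_intror erefl).
  rewrite /Qi /= !w_coord ?normrN ?(ger0_norm t0)// => h1 h2.
  by rewrite /h gt_max h2.
have h0 : h 0 < d / 2.
  by move: Qw0; rewrite /Qi /= w_coord// /h addr0 subr0 maxxx.
have hlt := real_induction_lt (ltW eta0) ch step h0.
(* The whole arc over [[c, c + eta]] stays in [Q], although its projection to coordinate [0] covers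
   the core. *)
have hit y : core s y -> `|il_coord x 0 - y| < r0.
  move=> cy; have [u /andP[cu ue] Tu] := hM0 M (leq_trans M0j (leq_addl _ _)) y cy.
  have u0 : 0 <= u - c <= eta by rewrite subr_ge0 cu /=; lra.
  have /andP[u1 u2] := u0; have nu : `|u - c| <= eta by rewrite ger0_norm.
  have [_] : U° (w (u - c)) /\ `|il_coord x 0 - il_coord (w (u - c)) 0| < r0.
    by apply: QO; apply: (hQ _ _ u0 _).1; exact/ltW/hlt.
  by rewrite w_coord// subn0 (_ : c + (u - c) = u) ?Tu//; ring.
have := hit _ (core_orb s_gt0 s_sq s_lt2 1); have := hit _ (core_orb s_gt0 s_sq s_lt2 2).
rewrite !ltr_norml => /andP[? ?] /andP[? ?].
have r0r0 : r0 + r0 = orb 1 - orb 2 by rewrite /r0 -splitr.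
lra.
Unshelve. all: by end_near. Qed.

End folding_of_omega.

(** * Folding points lie over the omega-limit set *)

(** The point [t0] supplies the pointed structure; the inverse is continuous because [f] is a closed
    map. *)
Lemma cantor_like_homeo (R : realType) (T : pseudoMetricType R) (t0 : T) :
  cantor_like T -> exists (f : cantor_space -> T) (g : T -> cantor_space),
    [/\ continuous f, continuous g, cancel f g & cancel g f].
Proof.
move=> cT; pose P := HB.pack_for (pseudoPMetricType R) T (isPointed.Build T t0).
have [f [cf clf]] := @homeomorphism_cantor_like R P cT.
have fg : cancel f f^-1%FUN by move=> k; apply: funK; rewrite in_setT.
have gf : cancel f^-1%FUN f by move=> y; apply: invK; exact: mem_set.
exists f, f^-1%FUN; split=> //.
apply/continuous_closedP => A clA.
rewrite (_ : _ @^-1` A = f @` A); first exact: clf.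
apply/seteqP; split=> [y Ay|_ [k Ak <-]]; first by exists (f^-1%FUN y).
by rewrite /preimage/= fg.
Qed.

Lemma set_type_hausdorff (T : topologicalType) (A : set T) :
  hausdorff_space T -> hausdorff_space (set_type A).
Proof.
move=> hT p q pq; apply: val_inj; apply: hT => B C nB nC.
have cv : continuous (\val : set_type A -> T) by exact: initial_continuous.
have [z [Bz Cz]] := pq _ _ (cv p B nB) (cv q C nC).
by exists (\val z).
Qed.

Lemma cvg_set_type (S : Type) (F : set_system S) {FF : Filter F}
    (T : topologicalType) (A : set T) (f : S -> set_type A) (p : set_type A) :
  (\val (f t)) @[t --> F] --> \val p -> f @ F --> p.
Proof.
move=> fp B [? [/= [W oW <-] Wp WB]].
have FW : ((fun t => \val (f t)) @ F) W by apply: fp; exact: open_nbhs_nbhs.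
by apply: (@filterS _ F _ [set t | W (\val (f t))]) => // t; exact: WB.
Qed.

Section orbit_free_points.
Context (R : realType) (s : R).
Hypotheses (s_gt0 : 0 < s) (s_sq : 2 < s ^+ 2) (s_lt2 : s < 2).

Local Notation c := (crit R).
Local Notation orb := (crit_orbit s).
Local Notation X := (core_inverse_limit s).
Local Notation K := (core_inverse_limit_set s).

(** Only finitely many [orb j] can be close to [x_i]. Passing to index [i + N] removes them: the
    [N]-th iterate sends [orb j] to [orb (N + j)], so closeness to [x_(i+N)] would give closeness of
    a late orbit point to [x_i]. *)
Lemma not_omega_orbit_free (x : X) i : ~ omega_limit s (il_coord x i) ->
  exists m, exists2 r, 0 < r & forall j, 3 * r <= `|orb j - il_coord x m|.
Proof.
move=> /omega_limitP nox.
have [e [e0 [N eN]]] : exists e, 0 < e /\ exists N, forall j, (N <= j)%N -> e <= `|orb j - il_coord x i|.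
  apply: contrapT => h; apply: nox => e e0 N.
  apply: contrapT => h'; apply: h; exists e; split => //; exists N => j Nj.
  by rewrite leNgt; apply/negP => je; apply: h'; exists j.
have sN := slope_pow_gt0 s_gt0 N.
(* The factor [3] leaves every point whose coordinate is within [r] of [x_m] free to slide by
   [2 * r], across the whole slab. *)
exists (i + N)%N; exists (e / s ^+ N / 3); first by rewrite !divr_gt0.
move=> j; rewrite mulrC divfK ?pnatr_eq0// ler_pdivrMr// mulrC.
apply: le_trans (iter_tent_lip s_gt0 _ _ _).
by rewrite il_iter -orbD; apply: eN; rewrite leq_addr.
Qed.

(** * The slab around an orbit-free coordinate, and sliding within it *)

Section neighbourhood.
Variables (x : X) (m : nat) (r : R).
Hypotheses (r_gt0 : 0 < r) (free : forall j, 3 * r <= `|orb j - il_coord x m|).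
Local Notation a := (il_coord x m).

Let U : set X := [set y | `|a - il_coord y m| < r].
Let slide (y : X) (t : R) : X := il_path y m t.

(** A coordinate too close to [c] would bring [y_m] within [2 * r] of an orbit point, which would
    then be within [3 * r] of [a]. *)
Lemma orbit_free_repelled (y : X) : U y -> crit_repelled s m (2 * r) (il_coord y).
Proof.
move=> Uy k; rewrite leNgt; apply/negP => h.
have := iter_tent_lip s_gt0 k.+1 (il_coord y (m + k.+1)%N) c.
rewrite il_iter => /le_lt_trans /(_ h); rewrite -/(orb k.+1) => yo.
have := free k.+1; rewrite leNgt => /negP; apply.
rewrite (le_lt_trans (ler_distD (il_coord y m) _ _))// distrC.
have -> : 3 * r = 2 * r + r by ring.
by rewrite ltrD// distrC; exact: Uy.
Qed.

Lemma orbit_free_neq_crit (y : X) k : U y -> il_coord y (m + k.+1)%N != c.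
Proof.
move=> Uy; have := orbit_free_repelled Uy k; apply: contraTneq => ->.
by rewrite subrr normr0 mulr0 -ltNge mulr_gt0.
Qed.

Lemma slide_il (y : X) t : U y -> `|a - t| < r ->
  K (branch_point s m (itinerary m (il_coord y)) t).
Proof.
move=> Uy ta; apply: (repelled_branch_point_il s_gt0 s_sq s_lt2 (orbit_free_repelled Uy)).
rewrite (le_trans (ler_distD a _ _))//; have -> : 2 * r = r + r by ring.
by rewrite lerD// ltW// distrC.
Qed.

Lemma slide_coord (y : X) t : U y -> `|a - t| < r ->
  il_coord (slide y t) = branch_point s m (itinerary m (il_coord y)) t.
Proof. by move=> Uy ta; rewrite /slide /il_path il_insubdE//; exact: slide_il. Qed.

Lemma slide_coordm (y : X) t : U y -> `|a - t| < r -> il_coord (slide y t) m = t.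
Proof. by move=> Uy ta; rewrite slide_coord// branch_point_id. Qed.

Lemma slide_U (y : X) t : U y -> `|a - t| < r -> U (slide y t).
Proof. by move=> Uy ta; rewrite /U /= slide_coordm. Qed.

Lemma branch_point_itineraryK sg (y : X) : U y ->
  il_coord y = branch_point s m sg (il_coord y m) ->
  itinerary m (il_coord y) = sg.
Proof.
move=> Uy ysg; rewrite ysg; apply: itinerary_branch_point => // k.
  by rewrite -(branch_pointD s m) -ysg; exact: il_coord_core.
by rewrite -(branch_pointD s m) -ysg; exact: orbit_free_neq_crit.
Qed.

Lemma slide_itinerary (y : X) t : U y -> `|a - t| < r ->
  itinerary m (il_coord (slide y t)) = itinerary m (il_coord y).
Proof.
move=> Uy ta; apply: branch_point_itineraryK; first exact: slide_U.
by rewrite slide_coordm// slide_coord.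
Qed.

(** Sliding preserves the itinerary, and the itinerary with the coordinate at [m] determines the
    point. *)
Lemma slideK (y : X) t u : U y -> `|a - t| < r -> `|a - u| < r ->
  slide (slide y t) u = slide y u.
Proof.
move=> Uy ta ua; apply: il_ext => i.
by rewrite (slide_coord (slide_U Uy ta) ua) slide_itinerary// slide_coord.
Qed.

Lemma slide_id (y : X) : U y -> slide y (il_coord y m) = y.
Proof.
move=> Uy; apply: il_ext => i; rewrite slide_coord// branch_point_itinerary//.
exact: il_coord_set.
Qed.

Lemma open_slab : open U.
Proof.
rewrite openE => y Uy; apply/nbhs_ilP => //; exists m, (r - `|a - il_coord y m|).
  by rewrite subr_gt0.
by move=> z yz; rewrite /U /= (le_lt_trans (ler_distD (il_coord y m) _ _))// addrC -ltrBrDr.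
Qed.

Lemma itinerary_locally_constant (y : X) n : U y -> \forall z \near y,
  forall k, (k < n)%N -> itinerary m (il_coord z) k = itinerary m (il_coord y) k.
Proof.
move=> Uy; elim: n => [|n IH]; first by apply/nbhs_ilP => //; exists 0%N, 1 => // z _ k; rewrite ltn0.
have : \forall z \near y, itinerary m (il_coord z) n = itinerary m (il_coord y) n.
  have := orbit_free_neq_crit n Uy; rewrite /itinerary.
  set yn := il_coord y _ => ync.
  apply/nbhs_ilP => //; exists (m + n.+1)%N, `|yn - c|; first by rewrite normr_gt0 subr_eq0.
  move=> z; rewrite -/yn; move: ync; case: (ltgtP yn c) => // yc _; rewrite ltr_norml.
    rewrite ltr0_norm ?subr_lt0// => /andP[? ?]; apply/negbTE; rewrite -ltNge; lra.
  by rewrite gtr0_norm ?subr_gt0// => /andP[? ?]; lra.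
apply: filterS2 IH => z h1 h2 k; rewrite ltnS leq_eqVlt => /predU1P[->//|].
exact: h1.
Qed.

(** Each coordinate of [slide] depends on finitely many itinerary entries; these are locally
    constant because the coordinates beyond [m] avoid [c]. *)
Lemma slide_continuous (y : X) t : U y -> `|a - t| < r ->
  slide z.1 z.2 @[z --> (y, t)] --> slide y t.
Proof.
move=> Uy ta; apply: cvg_il => // i; rewrite slide_coord//.
have nU : \forall z \near (y, t), U z.1 /\ `|a - z.2| < r.
  have n1 : nbhs y U by apply: open_nbhs_nbhs; split => //; exact: open_slab.
  have n2 : nbhs t [set u | `|a - u| < r].
    apply/nbhs_ballP; exists (r - `|a - t|); rewrite /= ?subr_gt0// => u.
    rewrite -ball_normE/= => tu.
    by rewrite (le_lt_trans (ler_distD t _ _))// addrC -ltrBrDr.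
  by exists (U, [set u | `|a - u| < r]).
have nI : \forall z \near (y, t), forall k, (k < i)%N ->
    itinerary m (il_coord z.1) k = itinerary m (il_coord y) k.
  exists ([set z | forall k, (k < i)%N ->
      itinerary m (il_coord z) k = itinerary m (il_coord y) k], setT).
    by split; [exact: itinerary_locally_constant|exact: filterT].
  by move=> [z u] [].
apply: (@cvg_trans _ ((fun z : X * R => branch_point s m (itinerary m (il_coord y)) z.2 i) @ (y, t))).
  apply: near_eq_cvg; apply: filterS2 nU nI => -[z u] /= [Uz ua] zy.
  rewrite slide_coord// /branch_point; case: ifP => // _.
  by apply: eq_branches => k ki; rewrite zy// (leq_trans ki)// leq_subr.
apply: (@cvg_comp _ _ _ snd (fun t => branch_point s m (itinerary m (il_coord y)) t i) _ (nbhs t)).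
  exact: cvg_snd.
exact: continuous_branch_point.
Qed.

(** * The fibre over [x_m] is a Cantor set *)

Let Fib : set X := [set y | il_coord y m = a].

Lemma Fib_U (y : X) : Fib y -> U y.
Proof. by rewrite /Fib /U /= => ->; rewrite subrr normr0. Qed.

Lemma dist_aa : `|a - a| < r. Proof. by rewrite subrr normr0. Qed.

Lemma slide_Fib (y : X) : U y -> Fib (slide y a).
Proof. by move=> Uy; exact: slide_coordm dist_aa. Qed.

Lemma Fib_compact : compact [set: set_type Fib].
Proof.
have cF : compact Fib.
  apply: (subclosed_compact _ (compact_il s_gt0 s_sq s_lt2)) => //.
  apply: (@preimage_closed _ _ (fun y : X => il_coord y m) [set z | z = a]).
    by move=> y _; exact: continuous_il_coord.
  exact: closed_eq.
have x0 : set_type Fib by exists x; apply: mem_set.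
have -> : [set: set_type Fib] = (insubd x0) @` Fib.
  rewrite eqEsubset; split => // y _; exists (\val y); first exact: set_mem (valP y).
  by rewrite valKd.
apply: continuous_compact cF.
apply: (@continuous_comp_initial _ (subspace Fib) _ set_val).
apply/subspace_continuousP => y Fy /=.
rewrite /= set_valE insubdK ?mem_set//.
apply: (@cvg_trans _ (id @ within Fib (nbhs y))).
  apply: near_eq_cvg; near=> z; rewrite /= insubdK//; apply: mem_set.
  by near: z; exact: withinT.
exact: cvg_within.
Unshelve. all: by end_near. Qed.

(** Distinct points of the fibre differ in an itinerary entry, and fixing that entry is a clopen
    condition since the coordinate never equals [c]. *)
Lemma Fib_zero_dimensional : zero_dimensional (set_type Fib).
Proof.
move=> y z yz.
have Fv (w : set_type Fib) : Fib (\val w) by exact: set_mem (valP w).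
have cv : continuous (\val : set_type Fib -> X) by exact: initial_continuous.
have [k kyz] : exists k, itinerary m (il_coord (\val y)) k != itinerary m (il_coord (\val z)) k.
  apply: contrapT => h; move/eqP: yz; apply; apply: val_inj.
  have yz : itinerary m (il_coord (\val y)) = itinerary m (il_coord (\val z)).
    by apply/funext => k; apply/eqP; apply: contrapT => kyz; apply: h; exists k; exact/negP.
  apply: il_ext => i.
  rewrite -(branch_point_itinerary s_gt0 m (il_coord_set (\val y))) yz.
  rewrite -[in RHS](branch_point_itinerary s_gt0 m (il_coord_set (\val z))).
  by rewrite (Fv y : il_coord _ _ = _) (Fv z : il_coord _ _ = _).
pose B : set (set_type Fib) := \val @^-1` [set w : X | c <= il_coord w (m + k.+1)%N].
have clB : clopen B.
  split.
    rewrite (_ : B = \val @^-1` ((fun w : X => il_coord w (m + k.+1)%N) @^-1` [set t | c < t])).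
      apply: open_comp; first by move=> w _; exact: cv.
      apply: open_comp; first by move=> w _; exact: continuous_il_coord.
      exact: open_gt.
    apply/seteqP; split=> w; rewrite /B /preimage/=; last exact: ltW.
    by move=> cw; rewrite lt_neqAle cw andbT eq_sym; exact/orbit_free_neq_crit/Fib_U/Fv.
  apply: preimage_closed; first by move=> w _; exact: cv.
  apply: (@preimage_closed _ _ (fun w : X => il_coord w (m + k.+1)%N) [set t | c <= t]).
    by move=> w _; exact: continuous_il_coord.
  exact: closed_ge.
have [By|nBy] := pselect (B y).
  exists B; split=> // Bz; move: kyz; rewrite /itinerary; move: By Bz.
  by rewrite /B /preimage/= => -> ->.
exists (~` B); split => //; first exact: clopenC.
move=> nBz; move: kyz; rewrite /itinerary; move: nBy nBz.
by rewrite /B /preimage/= => /negP/negbTE-> /negP/negbTE->.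

Qed.

(** Two distinct points near [e] share its coordinates up to [m + n], then follow right branches for
    [l] steps until the value is at least [orb 3], where both branches stay in the core. *)
Lemma Fib_perfect : perfect_set [set: set_type Fib].
Proof.
apply/perfectTP_ex => V oV [e Ve].
have Fe : Fib (\val e) by exact: set_mem (valP e).
move: oV => [W oW WV]; have We : nbhs (\val e) W.
  by apply: open_nbhs_nbhs; split => //; move: Ve; rewrite -WV.
move/(nbhs_ilP s_gt0 s_sq s_lt2) : We => [n [d d0 dW]].
set sg := itinerary m (il_coord (\val e)); pose v := il_coord (\val e) (m + n).
have sge k : branches s sg k a = il_coord (\val e) (m + k).
  rewrite -[in LHS](Fe : il_coord _ m = _); apply: branches_itinerary => //.
  exact: il_coord_set.
have [l hl] := branches_true_ge_orb3 s_gt0 s_sq v.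
(* The tail after index [m + n]: right branches throughout, except for the free choice [b] at step
   [l]. *)
pose tl b i := if i == l then b else true.
pose sg' b k := if (k < n)%N then sg k else tl b (k - n)%N.
have cv : core s v by exact: il_coord_core.
have ctl b i : core s (branches s (tl b) i v).
  elim: i => [//|i IH] /=; rewrite {1}/tl; case: eqP => [->|_]; last exact: core_branch_true.
  have -> : branches s (tl b) l v = branches s (fun=> true) l v.
    by apply: eq_branches => j jl; rewrite /tl lt_eqF.
  have cl := core_branches_true s_gt0 s_sq l cv.
  case: b {IH}; first exact: core_branch_true.
  by apply: core_branch_false => //; rewrite hl; have /coreP/andP[] := cl.
have low b k : (k <= n)%N -> branches s (sg' b) k a = il_coord (\val e) (m + k).
  move=> kn; rewrite -sge; apply: eq_branches => i ik.
  by rewrite /sg' (leq_trans ik kn).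
have csg b k : core s (branches s (sg' b) k a).
  have [kn|/ltnW nk] := leqP k n; first by rewrite low//; exact: il_coord_core.
  rewrite -(subnKC nk) branchesD low// (_ : (fun i => _) = tl b)//.
  by apply/funext => i; rewrite /sg' ltnNge leq_addr/= addKn.
have Kb b : K (branch_point s m (sg' b) a) by exact: branch_point_il.
pose z b : X := insubd x (branch_point s m (sg' b) a).
have zE b : il_coord (z b) = branch_point s m (sg' b) a by rewrite il_insubdE.
have Fz b : Fib (z b) by rewrite /Fib /= zE branch_point_id.
have Wz b : W (z b).
  apply: dW; suff -> : il_coord (z b) n = il_coord (\val e) n by rewrite subrr normr0.
  apply: (@il_coord_eq_le _ _ _ _ (m + n)%N); first exact: leq_addl.
  by rewrite zE branch_pointD low.
pose z' b : set_type Fib := SigSub (mem_set (Fz b)).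
exists (z' true), (z' false); rewrite -WV; split; [exact: Wz|exact: Wz|].
apply/eqP => /(congr1 (fun w : set_type Fib => itinerary m (il_coord (\val w)) (n + l)%N)).
have itz b : itinerary m (il_coord (z b)) = sg' b.
  by apply: branch_point_itineraryK; [exact/Fib_U/Fz|rewrite zE branch_point_id].
by rewrite /= !itz /sg' ltnNge leq_addr/= addKn /tl eqxx.
Qed.

Lemma Fib_cantor_like : cantor_like (set_type Fib).
Proof.
split; [exact: Fib_perfect|exact: Fib_compact| |exact: Fib_zero_dimensional].
exact/set_type_hausdorff/il_hausdorff.
Qed.

(** A point of the slab corresponds to its slide into the fibre together with its coordinate at [m];
    the inverse slides back. *)
Lemma slab_homeomorphic : homeomorphic U (@cantor_times_interval R).
Proof.
have Fx : Fib x by [].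
have [psi [phi [cpsi cphi psiK phiK]]] :=
  @cantor_like_homeo R (set_type Fib) (SigSub (mem_set Fx)) Fib_cantor_like.
have r0 := r_gt0.
pose toF (y : X) : set_type Fib := insubd (SigSub (mem_set Fx)) (slide y a).
(* The affine bijection from the unit interval onto the range of the coordinate at [m]. *)
pose h (t : R) := a - r + 2 * r * t.
have h_in t : `]0, 1[%classic t -> `|a - h t| < r.
  rewrite /= in_itv/= => /andP[t0 t1]; rewrite /h ltr_norml.
  by apply/andP; split; nra.
have h_inv t : `|a - t| < r -> `]0, 1[%classic ((t - (a - r)) / (2 * r)).
  rewrite ltr_norml /= in_itv/= => /andP[h1 h2].
  by rewrite divr_gt0 ?mulr_gt0//= ?ltr_pdivrMr ?mulr_gt0//; lra.
have hK t : h ((t - (a - r)) / (2 * r)) = t.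
  by rewrite /h; field; rewrite gt_eqF.
have h'K t : (h t - (a - r)) / (2 * r) = t.
  by rewrite /h; field; rewrite gt_eqF.
have Fval (w : set_type Fib) : Fib (\val w) by exact: set_mem (valP w).
have Uval (w : set_type Fib) : U (\val w) by exact/Fib_U/Fval.
have toFE y : U y -> \val (toF y) = slide y a.
  by move=> Uy; rewrite insubdK//; apply/mem_set/slide_Fib.
have toF_val (w : set_type Fib) t : `|a - t| < r -> toF (slide (\val w) t) = w.
  move=> ta; apply: val_inj; rewrite toFE; last exact: slide_U.
  rewrite slideK//; last exact: dist_aa.
  by rewrite -[X in slide _ X](Fval w) slide_id.
exists (fun y => (phi (toF y), (il_coord y m - (a - r)) / (2 * r))).
exists (fun z => slide (\val (psi z.1)) (h z.2)); split.
- by move=> y Uy; split => //; exact: h_inv.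
- by move=> [k t] [_ /h_in ta]; apply: slide_U => //; exact: Uval.
- apply/subspace_continuousP => y Uy; apply: cvg_within_filter.
  apply: (@cvg_pair _ _ _ _ (nbhs (phi (toF y))) (nbhs ((il_coord y m - (a - r)) / (2 * r)))).
    apply: (@cvg_comp _ _ _ toF phi _ (nbhs (toF y))); last exact: cphi.
    apply: cvg_set_type; rewrite toFE//.
    apply: (@cvg_trans _ (slide z a @[z --> y])).
      apply: near_eq_cvg; have : nbhs y U by apply: open_nbhs_nbhs; split => //; exact: open_slab.
      by apply: filterS => z Uz; rewrite toFE.
    apply: (@cvg_comp _ _ _ (fun z => (z, a)) (fun z => slide z.1 z.2) _ (nbhs (y, a))).
      apply: (@cvg_pair _ _ _ (nbhs y) (nbhs y) (nbhs a) (nbhs_filter y)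
        (nbhs_filter y) (nbhs_filter a) id (fun=> a)); [exact: cvg_id|exact: cvg_cst].
    by apply: slide_continuous => //; exact: dist_aa.
  apply: (@cvg_comp _ _ _ (fun z : X => il_coord z m) (fun t => (t - (a - r)) / (2 * r))
    _ (nbhs (il_coord y m))); first exact: continuous_il_coord.
  have cK : continuous (fun t : R^o => (t - (a - r)) / (2 * r) : R^o).
    move=> t; apply: cvgMl; apply: cvgB; [exact: cvg_id|exact: cvg_cst].
  exact: cK.
- apply/subspace_continuousP => -[k t] [_ /h_in ta]; apply: cvg_within_filter => /=.
  apply: (@cvg_comp _ _ _ (fun z => (\val (psi z.1), h z.2)) (fun z => slide z.1 z.2) _
    (nbhs (\val (psi k), h t))); last exact: slide_continuous.
  apply: (@cvg_pair _ _ _ _ (nbhs (\val (psi k))) (nbhs (h t))).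
    apply: (@cvg_comp _ _ _ (fun z : cantor_space * R => psi z.1)
      (fun w : set_type Fib => \val w) _ (nbhs (psi k))).
      apply: (@cvg_comp _ _ _ fst psi _ (nbhs k)); [exact: cvg_fst|exact: cpsi].
    exact: initial_continuous.
  apply: (@cvg_comp _ _ _ snd h _ (nbhs t)); first exact: cvg_snd.
  apply: (@cvgD R R^o); first exact: cvg_cst.
  by apply: (@cvgM R R^o); [exact: cvg_cst|exact: cvg_id].
- split=> [y Uy|[k t] [_ /h_in ta]] /=.
    by rewrite phiK hK toFE// slideK ?slide_id//; exact: dist_aa.
  rewrite toF_val// psiK slide_coordm//; last exact: Uval.
  exact: (congr1 (pair k) (h'K t)).
Qed.

Lemma orbit_free_not_folding : ~ folding_points s x.
Proof.
apply; exists U; last exact: slab_homeomorphic.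
by apply: open_nbhs_nbhs; split; [exact: open_slab|exact: dist_aa].
Qed.

End neighbourhood.

Lemma folding_in_omega (x : X) : folding_points s x -> in_omega s (il_coord x).
Proof.
move=> fx i; apply: contrapT => /not_omega_orbit_free[m [r r0 free]].
exact: orbit_free_not_folding free fx.
Qed.

End orbit_free_points.

(** * The theorem *)

Theorem theorem3p9 (R : realType) (s : R) (s_gt : Num.sqrt 2 < s) (s_lt : s < 2) :
  folding_points s = endpoints s <-> persistently_recurrent s.
Proof.
have s_gt0 : 0 < s by exact: le_lt_trans (sqrtr_ge0 _) s_gt.
have s_sq : 2 < s ^+ 2.
  by rewrite -[ltLHS](@sqr_sqrtr R) ?ler0n// ltrXn2r// nnegrE ?sqrtr_ge0// ltW.
split=> [FE|[rec nrel]].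
  (* Such a point would be a folding point without being an endpoint. *)
  have no_repelled (x : core_inverse_limit s) d : 0 < d -> in_omega s (il_coord x) ->
      ~ crit_repelled s 0 d (il_coord x).
    move=> d0 ox xd; apply: (repelled_not_endpoint s_gt0 s_sq s_lt d0 xd).
    by rewrite -FE; exact: in_omega_folding.
  have rec : recurrent s.
    apply: contrapT => nrec; have [x ox] := exists_in_omega s_gt0 s_sq s_lt.
    have [d d0 xd] := nonrecurrent_repelled s_gt0 s_sq nrec ox.
    exact: no_repelled d0 ox xd.
  split=> // /(reluctant_repelled s_gt0 s_sq s_lt)[x ox [d d0 xd]].
  exact: no_repelled d0 ox xd.
apply/seteqP; split=> x; last exact: endpoint_folding.
move=> /(folding_in_omega s_gt0 s_sq s_lt) ox; apply: contrapT.
move=> /(not_endpoint_repelled s_gt0 s_sq s_lt)[n [d d0 xd]].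
by apply: nrel; exact: repelled_reluctant rec d0 ox xd.
Qed.
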